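(* Let $u=\mathrm{diag}\{1,e^{i\alpha_1},e^{i\alpha_2}\}F_3$ and $v=\mathrm{diag}\{1,e^{i\beta_1},e^{i\beta_2}\}F_3$ with $\alpha_1,\alpha_2,\beta_1,\beta_2\in[0,2\pi)$, and assume $u\nsim v$. The following are equivalent. (i) The quadruple $(R_u\cap R_v\subset R_u,R_v\subset R)$ of $II_1$ factors is a commuting square. (ii) The quadruple $(\mathbb{C}\subset u\Delta_3u^*,v\Delta_3v^*\subset M_3)$ of finite-dimensional $C^*$-algebras is a commuting square. (iii) $\big(e^{i(\alpha_1-\beta_1)},e^{i(\alpha_2-\beta_2)}\big)\in\{(\omega,\omega),(\omega^2,\omega^2),(1,\omega),(1,\omega^2),(\omega,1),(\omega^2,1)\}$, where $\omega$ is a primitive cube root of unity.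
   Context: Matrices. $M_3$ is the algebra of $3\times3$ complex matrices, $\Delta_3\subset M_3$ the diagonal subalgebra, $E_{ij}$ the matrix units, $M_3^{(k)}=M_3^{\otimes k}$ with identity $I_3^{(k)}$ ($M_3^{(0)}=\mathbb{C}$), and $\mathrm{Ad}_w(x)=wxw^*$. A complex Hadamard matrix of order $3$ is a unitary $u\in M_3$ all of whose entries have modulus $1/\sqrt3$. $F_3=\frac1{\sqrt3}(\omega_0^{jk})_{0\le j,k\le2}$ with $\omega_0=e^{-2\pi i/3}$. For complex Hadamard matrices, $u\sim v$ means $v=uPD$ for some permutation matrix $P$ and diagonal unitary matrix $D$. Hadamard (spin model) subfactors. For $k\ge 0$ put $A_{2k}=M_3\otimes M_3^{(k)}$ and $A_{2k+1}=\Delta_3\otimes M_3\otimes M_3^{(k)}$, with embeddings $A_{2k}\subset A_{2k+1}$, $x\mapsto I_3\otimes x$, and $A_{2k+1}\subset A_{2k+2}$ induced by $\Delta_3\subset M_3$ in the first tensor factor. $R$ is the hyperfinite $II_1$ factor obtained as the strong closure of $\bigcup_k A_k$ in the GNS representation of the unique compatible normalized trace. For a complex Hadamard matrix $u=(u_{ij})$ of order $3$ let $D_u=\sqrt3\sum_{i,j}\overline{u_{ij}}\,E_{ii}\otimes E_{jj}$, $u_0=u$, and for $k\ge0$: $u_{2k+1}=(I_3\otimes u_{2k})(D_u\otimes I_3^{(k)})$, $u_{2k+2}=u_{2k+1}(u\otimes I_3^{(k+1)})$. Put $B^u_{2k}=\mathrm{Ad}_{u_{2k}}(\Delta_3\otimes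 M_3^{(k)})\subset A_{2k}$ and $B^u_{2k+1}=\mathrm{Ad}_{u_{2k+1}}(\mathbb{C}\otimes M_3\otimes M_3^{(k)})\subset A_{2k+1}$. These form an increasing sequence, and the Hadamard subfactor $R_u\subset R$ is the strong closure of $\bigcup_k B^u_k$. When $u\nsim v$, $R_u\cap R_v$ is a $II_1$ factor with $[R:R_u\cap R_v]=9$. A quadruple $(N\subset P,Q\subset M)$ of finite von Neumann algebras ($N\subset P\cap Q$, $P,Q\subset M$, with a fixed faithful normal tracial state on $M$; the normalized trace for $M_3$ and for $R$) is a commuting square if the trace-preserving conditional expectations satisfy $E_PE_Q=E_QE_P=E_N$ on $M$. *)

(* Defs.v *)
From HB Require Import structures.
From mathcomp Require Import all_boot all_order all_algebra all_fingroup.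
From mathcomp Require Export sesquilinear spectral.
From mathcomp Require Export complex mxtens.
From mathcomp Require Import all_classical all_reals all_analysis.

Set Implicit Arguments.
Unset Strict Implicit.
Unset Printing Implicit Defensive.

Import Order.TTheory GRing.Theory Num.Theory.
Import numFieldNormedType.Exports.

Local Open Scope classical_set_scope.
Local Open Scope ring_scope.
Local Open Scope complex_scope.
Local Open Scope sesquilinear_scope.

Section CommutingSquare.
(* [V] carries the elements, with product [mul]; [pos] are the positive ones.
   The algebras are subsets of [V]; this covers both matrices and bounded
   operators on a Hilbert space. *)
Variables (K : numFieldType) (V : lmodType K).
Variables (mul : V -> V -> V) (pos : set V) (tau : V -> K).

(* The values of [E] outside [M] are irrelevant. *)
Record trace_preserving_cond_exp (M N : set V) (E : V -> V) : Prop := {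
  cond_exp_into : forall x, M x -> N (E x);
  cond_exp_linear : forall (a : K) x y, M x -> M y ->
    E (a *: x + y) = a *: E x + E y;
  cond_exp_pos : forall x, M x -> pos x -> pos (E x);
  cond_exp_id : forall x, N x -> E x = x;
  cond_exp_bimod : forall a x b, N a -> M x -> N b ->
    E (mul (mul a x) b) = mul (mul a (E x)) b;
  cond_exp_trace : forall x, M x -> tau (E x) = tau x }.

(* [N `<=` P, Q `<=` M]; the conditional expectations are unique when [tau] is
   a faithful trace on [M]. *)
Definition commuting_square (N P Q M : set V) : Prop :=
  [/\ N `<=` P `&` Q, P `<=` M, Q `<=` M &
   exists EP EQ EN : V -> V,
   [/\ trace_preserving_cond_exp M P EP,
       trace_preserving_cond_exp M Q EQ,
       trace_preserving_cond_exp M N EN &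
       forall x, M x -> EP (EQ x) = EN x /\ EQ (EP x) = EN x]].

End CommutingSquare.

Definition Ad (C : numClosedFieldType) n (w x : 'M[C]_n) : 'M[C]_n :=
  w *m x *m w^t*.

Definition psdmx (C : numClosedFieldType) n : set 'M[C]_n :=
  [set x | forall xi : 'cV[C]_n, 0 <= (xi^t* *m x *m xi) 0 0].

Definition ntrace (C : numClosedFieldType) n (x : 'M[C]_n) : C :=
  \tr x / n%:R.

Definition Delta3 (C : numClosedFieldType) : set 'M[C]_3 :=
  [set x | is_diag_mx x].
Arguments Delta3 : clear implicits.

Definition scalars3 (C : numClosedFieldType) : set 'M[C]_3 :=
  [set x | exists c : C, x = c%:M].
Arguments scalars3 : clear implicits.

Definition hadamard_equiv (C : numClosedFieldType) (u v : 'M[C]_3) : Prop :=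
  exists (s : 'S_3) (d : 'rV[C]_3),
    (forall i, `|d 0 i| = 1) /\ v = u *m perm_mx s *m diag_mx d.

(* Size of the matrices in the k-th tensor power of M_3. Unlike [3 ^ k], it
   makes ['M_(3 * dim3 k)] and ['M_(dim3 k.+1)] convertible for every [k]. *)
Fixpoint dim3 (k : nat) : nat := if k is j.+1 then (3 * dim3 j)%N else 1%N.

Section Tower.
Variable C : numClosedFieldType.

(* Delta_3 (x) M_3^(k), as its elements are exactly the \sum_i E_ii (x) x_i. *)
Definition Delta_tens (k : nat) : set 'M[C]_(dim3 k.+1) :=
  [set y | exists x : 'I_3 -> 'M[C]_(dim3 k),
             y = \sum_i delta_mx i i *t x i].
Arguments Delta_tens : clear implicits.

Definition one_tens (k : nat) : set 'M[C]_(dim3 k.+1) :=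
  [set y | exists x : 'M[C]_(dim3 k), y = (1%:M : 'M[C]_3) *t x].
Arguments one_tens : clear implicits.

(* A_(2k) = M_3 (x) M_3^(k) and A_(2k+1) = Delta_3 (x) M_3 (x) M_3^(k). The
   latter is a set of matrices of M_3 (x) M_3^(k+1) = A_(2k+2), so that the
   embedding of A_(2k+1) in A_(2k+2) is an inclusion. *)
Definition A_even (k : nat) : set 'M[C]_(dim3 k.+1) := setT.
Definition A_odd (k : nat) : set 'M[C]_(dim3 k.+2) := Delta_tens k.+1.

(* D_u (x) I_3^(k), as an element of M_3 (x) (M_3 (x) M_3^(k)) *)
Definition D_tens (u : 'M[C]_3) (k : nat) : 'M[C]_(dim3 k.+2) :=
  sqrtC 3 *: \sum_i \sum_j (u i j)^* *:
    ((delta_mx i i : 'M[C]_3) *t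
       ((delta_mx j j : 'M[C]_3) *t (1%:M : 'M[C]_(dim3 k)))).

(* u_(2k+1), given u_(2k) *)
Definition u_next (u : 'M[C]_3) (k : nat) (w : 'M[C]_(dim3 k.+1)) :
    'M[C]_(dim3 k.+2) :=
  ((1%:M : 'M[C]_3) *t w) *m D_tens u k.

Fixpoint u_even (u : 'M[C]_3) (k : nat) : 'M[C]_(dim3 k.+1) :=
  if k is j.+1 return 'M[C]_(dim3 k.+1)
  then u_next u (u_even u j) *m (u *t (1%:M : 'M[C]_(dim3 j.+1)))
  else u *t (1%:M : 'M[C]_(dim3 0)).

Definition u_odd (u : 'M[C]_3) (k : nat) : 'M[C]_(dim3 k.+2) :=
  u_next u (u_even u k).

Definition B_even (u : 'M[C]_3) (k : nat) : set 'M[C]_(dim3 k.+1) :=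
  Ad (u_even u k) @` Delta_tens k.

Definition B_odd (u : 'M[C]_3) (k : nat) : set 'M[C]_(dim3 k.+2) :=
  Ad (u_odd u k) @` one_tens k.+1.

End Tower.

Arguments A_even {C} k _.
Arguments A_odd {C} k _.
Arguments B_even {C} u k _.
Arguments B_odd {C} u k _.

(* A GNS representation, for the normalized trace, of the union of the A_k. As
   the A_(2k) are cofinal, it is a compatible family of *-representations of
   the full matrix algebras A_(2k) on a Hilbert space, the embedding of A_(2k)
   in A_(2k+2) being [x |-> 1 *t x]. It is unique up to unitary equivalence. *)
Record gns (R : realType) := GNS {
  gns_space :> completeNormedModType R[i];
  gns_dot : {dot gns_space for @Num.conj R[i]};
  gns_norm : forall xi, gns_dot xi xi = `|xi| ^+ 2;
  gns_rep : forall k : nat, 'M[R[i]]_(dim3 k.+1) -> gns_space -> gns_space;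
  gns_vec : gns_space;
  gns_rep_linear : forall k x, linear (@gns_rep k x);
  gns_rep_continuous : forall k x, continuous (@gns_rep k x);
  gns_repP : forall k (a : R[i]) (x y : 'M[R[i]]_(dim3 k.+1)) xi,
    @gns_rep k (a *: x + y) xi = a *: gns_rep x xi + gns_rep y xi;
  gns_repM : forall k x y xi, @gns_rep k (x *m y) xi = gns_rep x (gns_rep y xi);
  gns_rep1 : forall k xi, @gns_rep k 1%:M xi = xi;
  gns_rep_adj : forall k x xi eta,
    gns_dot (@gns_rep k x xi) eta = gns_dot xi (gns_rep (x^t*) eta);
  gns_rep_compat : forall k (x : 'M[R[i]]_(dim3 k.+1)),
    @gns_rep k.+1 ((1%:M : 'M[R[i]]_3) *t x) = gns_rep x;
  gns_state : forall k x, gns_dot (@gns_rep k x gns_vec) gns_vec = ntrace x;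
  gns_cyclic :
    dense [set xi | exists k (x : 'M[R[i]]_(dim3 k.+1)), xi = gns_rep x gns_vec]
}.

Section Factors.
Variables (R : realType) (H : gns R).

(* Closure, within the bounded operators, for the strong operator topology *)
Definition strong_closure (S : set (H -> H)) : set (H -> H) :=
  [set T | [/\ linear T, continuous T & closure (S : set {ptws H -> H}) T]].

Definition op_pos : set (H -> H) :=
  [set T | forall xi, 0 <= gns_dot H (T xi) xi].

Definition op_trace (T : H -> H) : R[i] :=
  gns_dot H (T (gns_vec H)) (gns_vec H).

Definition hyperfinite_factor : set (H -> H) :=
  strong_closure (\bigcup_k (@gns_rep R H k @` A_even k `|`
                             @gns_rep R H k.+1 @` A_odd k)).

Definition hadamard_subfactor (u : 'M[R[i]]_3) : set (H -> H) :=
  strong_closure (\bigcup_k (@gns_rep R H k @` B_even u k `|`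
                             @gns_rep R H k.+1 @` B_odd u k)).

Definition op_commuting_square (N P Q M : set (H -> H)) : Prop :=
  commuting_square (fun S T : H -> H => S \o T) op_pos op_trace N P Q M.

End Factors.

Arguments hyperfinite_factor {R} H _.
Arguments hadamard_subfactor {R} H u _.

Definition mx_commuting_square (R : realType) (N P Q M : set 'M[R[i]]_3) :
    Prop :=
  commuting_square (fun x y : 'M[R[i]]_3 => x *m y) (@psdmx R[i] 3)
    (@ntrace R[i] 3) N P Q M.

Definition cis (R : realType) (t : R) : R[i] := cos t +i* sin t.

Definition F3 (R : realType) : 'M[R[i]]_3 :=
  (sqrtC 3)^-1 *:
    \matrix_(j < 3, k < 3) cis (- (2 * pi / 3) : R) ^+ (j * k).

Definition phaseF3 (R : realType) (t1 t2 : R) : 'M[R[i]]_3 :=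
  diag_mx (\row_(j < 3) [:: 1; cis t1; cis t2]`_j) *m F3 R.

(* Main.v *)
(* Let S be the cyclic shift of C^3. For u = diag(gam) F_3 put
   T_u = diag(gam) S diag(gam)^*, so that T_u u = u Z with Z diagonal with
   distinct entries. Then W_k = S (x) ... (x) S (x) T_u satisfies
   W_k u_(2k) = u_(2k) (Z (x) 1), whence B^u_(2k) is the fixed point algebra of
   Ad W_k in A_(2k). These automorphisms of order 3 are compatible with the
   embeddings and preserve the trace; they extend to R, with fixed point algebra
   R_u, and the conditional expectation onto R_u is the average over the three
   powers.

   If either quadruple is a commuting square, then the averages for u and v
   commute on M_3. Since T_v = diag(r) T_u, applying this to T_v shows that r
   has mean 0 or is constant. In the second case u ~ v; in the first, r_0, r_1,
   r_2 are proportional to the three cube roots of unity, which is (iii).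
   Conversely, (iii) implies T_u T_v = c T_v T_u for a scalar c <> 1.
   Then the automorphisms commute, hence so do the averages, and only
   scalars commute with both T_u and T_v. *)
Require Import Defs.
From mathcomp Require Import all_boot all_order all_algebra all_fingroup.
From mathcomp Require Import all_classical all_reals all_analysis.
From mathcomp Require Import ring lra.

Set Implicit Arguments.
Unset Strict Implicit.
Unset Printing Implicit Defensive.

Import Order.TTheory GRing.Theory Num.Theory.
Import numFieldNormedType.Exports.

Local Open Scope classical_set_scope.
Local Open Scope ring_scope.
Local Open Scope complex_scope.
Local Open Scope sesquilinear_scope.

(** * Abstract commuting squares and averages over automorphisms of order 3 *)

Section AbstractCommutingSquares.
Variables (K : numFieldType) (V : lmodType K).
Variables (mul : V -> V -> V) (pos : set V) (tau : V -> K).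

Section Composition.
Variables (M P Q : set V) (E F : V -> V).
Hypothesis PM : P `<=` M.
Hypothesis QM : Q `<=` M.
Hypothesis condE : trace_preserving_cond_exp mul pos tau M P E.
Hypothesis condF : trace_preserving_cond_exp mul pos tau M Q F.
Hypothesis EFC : forall x, M x -> E (F x) = F (E x).

(** Because [E] and [F] commute, the values of the composite lie in both ranges; every other
    property passes through the two maps in turn. *)
Lemma cond_exp_comp :
  trace_preserving_cond_exp mul pos tau M (P `&` Q) (fun x => E (F x)).
Proof.
have MF x : M x -> M (F x) by move=> /(cond_exp_into condF)/QM.
have ME x : M x -> M (E x) by move=> /(cond_exp_into condE)/PM.
split.
- move=> x Mx; split; first exact: (cond_exp_into condE (MF _ Mx)).
  by rewrite EFC //; apply: (cond_exp_into condF (ME _ Mx)).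
- move=> a x y Mx My.
  rewrite (cond_exp_linear condF) // (cond_exp_linear condE) //; exact: MF.
- move=> x Mx posx.
  exact: (cond_exp_pos condE (MF _ Mx) (cond_exp_pos condF Mx posx)).
- by move=> x [Px Qx]; rewrite (cond_exp_id condF Qx) (cond_exp_id condE Px).
- move=> a x b [Pa Qa] Mx [Pb Qb].
  by rewrite (cond_exp_bimod condF) // (cond_exp_bimod condE) //; exact: MF.
- move=> x Mx.
  by rewrite (cond_exp_trace condE (MF _ Mx)) (cond_exp_trace condF Mx).
Qed.

Lemma commuting_cond_exp_square : commuting_square mul pos tau (P `&` Q) P Q M.
Proof.
split=> //.
exists E, F, (fun x => E (F x)); split=> //; first exact: cond_exp_comp.
by move=> x Mx; rewrite -EFC.
Qed.

End Composition.

Section TraceIdentity.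
Variables (N P Q M : set V) (e : V) (F G : V -> V).
Hypothesis square : commuting_square mul pos tau N P Q M.
Hypothesis condF : trace_preserving_cond_exp mul pos tau M P F.
Hypothesis condG : trace_preserving_cond_exp mul pos tau M Q G.
Hypothesis Ne : N e.
Hypothesis mul1e : forall x, mul e x = x.
Hypothesis mule1 : forall x, mul x e = x.
Hypothesis Mmul : forall x y, M x -> M y -> M (mul x y).

(** The unit [e] lies in the range, so the bimodule identity can be used with [e] on one side; then
    [E] preserves the trace. *)
Lemma cond_exp_trace_mulr (P0 : set V) (E : V -> V) x a :
  trace_preserving_cond_exp mul pos tau M P0 E -> P0 e -> P0 `<=` M ->
  M x -> P0 a -> tau (mul (E x) a) = tau (mul x a).
Proof.
move=> condE Pe PM Mx Pa.
have := cond_exp_bimod condE Pe Mx Pa; rewrite !mul1e => <-.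
by apply: (cond_exp_trace condE); apply: Mmul => //; apply: PM.
Qed.

Lemma cond_exp_trace_mull (P0 : set V) (E : V -> V) x a :
  trace_preserving_cond_exp mul pos tau M P0 E -> P0 e -> P0 `<=` M ->
  M x -> P0 a -> tau (mul a (E x)) = tau (mul a x).
Proof.
move=> condE Pe PM Mx Pa.
have := cond_exp_bimod condE Pa Mx Pe; rewrite !mule1 => <-.
by apply: (cond_exp_trace condE); apply: Mmul => //; apply: PM.
Qed.

(* Both sides equal [tau (EN x * EN y)], [EN] being the conditional expectation
   onto [N]; in this way the uniqueness of conditional expectations, which would
   need adjoints in [M], is avoided. *)
Lemma commuting_square_tau x y : M x -> M y ->
  tau (mul x (G (F y))) = tau (mul x (F (G y))).
Proof.
move=> Mx My; case: square => NPQ PM QM [EP [EQ [EN [cP cQ cN EC]]]].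
have NP : N `<=` P by move=> z /NPQ[].
have NQ : N `<=` Q by move=> z /NPQ[].
have NM z : N z -> M z by move=> /NP/PM.
have inF z : M z -> P (F z) by exact: (cond_exp_into condF).
have inG z : M z -> Q (G z) by exact: (cond_exp_into condG).
have inN z : M z -> N (EN z) by exact: (cond_exp_into cN).
have [Pe Qe] := (NP _ Ne, NQ _ Ne).
(* [EQ] is the identity on [Q], so [EP EQ = EN] reduces there to [EP = EN]; the next claim is the
   same with [P] and [Q] exchanged. *)
have EPQ z : Q z -> EN z = EP z.
  by move=> Qz; have [<- _] := EC _ (QM _ Qz); rewrite (cond_exp_id cQ Qz).
have EQP z : P z -> EN z = EQ z.
  by move=> Pz; have [_ <-] := EC _ (PM _ Pz); rewrite (cond_exp_id cP Pz).
(* [N] lies in [P], so [F z] and [z] have the same traces against elements of [N]; hence [EN] does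
   not separate them under the trace. *)
have ENF z a : M z -> N a ->
    tau (mul a (EN (F z))) = tau (mul a (EN z)) /\
    tau (mul (EN (F z)) a) = tau (mul (EN z) a).
  move=> Mz Na; have MF := PM _ (inF z Mz); split.
    rewrite !(cond_exp_trace_mull cN) // ?NM //; try by move=> ? /NM.
    by rewrite (cond_exp_trace_mull condF) //; apply: NP.
  rewrite !(cond_exp_trace_mulr cN) // ?NM //; try by move=> ? /NM.
  by rewrite (cond_exp_trace_mulr condF) //; apply: NP.
have ENG z a : M z -> N a ->
    tau (mul a (EN (G z))) = tau (mul a (EN z)) /\
    tau (mul (EN (G z)) a) = tau (mul (EN z) a).
  move=> Mz Na; have MG := QM _ (inG z Mz); split.
    rewrite !(cond_exp_trace_mull cN) // ?NM //; try by move=> ? /NM.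
    by rewrite (cond_exp_trace_mull condG) //; apply: NQ.
  rewrite !(cond_exp_trace_mulr cN) // ?NM //; try by move=> ? /NM.
  by rewrite (cond_exp_trace_mulr condG) //; apply: NQ.
have MFx := inF x Mx; have MFy := inF y My.
have MGx := inG x Mx; have MGy := inG y My.
have subNM : N `<=` M by move=> z /NM.
transitivity (tau (mul (EN x) (EN y))).
  rewrite -(cond_exp_trace_mulr condG) //; last by exact: inG (PM _ MFy).
  rewrite (cond_exp_trace_mull condG) //; last exact: PM.
  rewrite -(cond_exp_trace_mull cQ) //; last exact: PM.
  rewrite -EQP // -(cond_exp_trace_mulr cN) //; try exact: QM.
    by rewrite (ENF y _ My (inN _ (QM _ MGx))).1 (ENG x _ Mx (inN _ My)).2.
  exact: inN (PM _ MFy).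
symmetry.
rewrite -(cond_exp_trace_mulr condF) //; last by exact: inF (QM _ MGy).
rewrite (cond_exp_trace_mull condF) //; last exact: QM.
rewrite -(cond_exp_trace_mull cP) //; last exact: QM.
rewrite -EPQ // -(cond_exp_trace_mulr cN) //; try exact: PM.
  by rewrite (ENG y _ My (inN _ (PM _ MFx))).1 (ENF x _ Mx (inN _ My)).2.
exact: inN (QM _ MGy).
Qed.

End TraceIdentity.

Section Average.
Variable theta : V -> V.

Definition avg3 (x : V) : V := 3^-1 *: (x + theta x + theta (theta x)).

Hypothesis theta_lin : linear theta.

Lemma avg3_linear : linear avg3.
Proof.
have [thZ thD] := GRing.semilinear_linear theta_lin.
move=> a x y; rewrite /avg3 !theta_lin.
rewrite scalerA (mulrC a) -scalerA -scalerDr !(scalerDr a).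
by rewrite (addrACA (a *: x)) (addrACA (_ + _)).
Qed.

Lemma avg3_fixed x : theta x = x -> avg3 x = x.
Proof.
move=> xE; rewrite /avg3 !xE -[x + x]mulr2n -(mulrSr x) -(scaler_nat 3 x).
by rewrite scalerA mulVf ?scale1r ?pnatr_eq0.
Qed.

Lemma theta_avg3 x : theta (theta (theta x)) = x -> theta (avg3 x) = avg3 x.
Proof.
have [thZ thD] := GRing.semilinear_linear theta_lin.
by move=> xE; rewrite /avg3 thZ !thD xE addrC addrA.
Qed.

Variable M : set V.
Hypothesis M_lin : forall (a : K) x y, M x -> M y -> M (a *: x + y).
Hypothesis theta_into : forall x, M x -> M (theta x).
Hypothesis thetaM : forall x y, theta (mul x y) = mul (theta x) (theta y).
Hypothesis theta3 : forall x, theta (theta (theta x)) = x.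
Hypothesis theta_pos : forall x, pos x -> pos (theta x).
Hypothesis theta_tau : forall x, tau (theta x) = tau x.
Hypothesis posD : forall x y, pos x -> pos y -> pos (x + y).
Hypothesis posZ : forall (a : K) x, 0 <= a -> pos x -> pos (a *: x).
Hypothesis mul_linl : forall z, linear (mul^~ z).
Hypothesis mul_linr : forall z, M z -> linear (mul z).
Hypothesis tau_lin : scalar tau.

(** Averaging over the powers of [theta] projects onto its fixed points. Linearity of [mul z] is
    asked for [z] in [M], because composing on the left with a map is linear only if that map is. *)
Lemma avg3_cond_exp :
  trace_preserving_cond_exp mul pos tau M (M `&` [set x | theta x = x]) avg3.
Proof.
have MD y z : M y -> M z -> M (y + z).
  by move=> My Mz; rewrite -[y]scale1r; apply: M_lin.
split.
- move=> x Mx; split; last exact: theta_avg3.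
  have M0 : M 0 by rewrite -(addNr x) -scaleN1r; apply: M_lin.
  rewrite /avg3 -[_ *: _]addr0; apply: M_lin => //.
  by apply: (MD); [apply: MD => //|]; do ?apply: (theta_into).
- by move=> a x y _ _; apply: avg3_linear.
- move=> x Mx posx; apply: posZ; first by rewrite invr_ge0 ler0n.
  by apply: (posD); [apply: (posD) => //|]; do ?apply: (theta_pos).
- by move=> x [_ xE]; apply: avg3_fixed.
- move=> a x b [Ma aE] Mx [Mb bE]; rewrite /= in aE bE.
  have [aZ aD] := GRing.semilinear_linear (mul_linr Ma).
  have [bZ bD] := GRing.semilinear_linear (mul_linl b).
  by rewrite /avg3 !thetaM !(aE, bE) aZ bZ !aD !bD.
- move=> x Mx; have [tauZ tauD] := GRing.semilinear_linear tau_lin.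
  by rewrite /avg3 tauZ !tauD !theta_tau /=; field.
Qed.

End Average.

Lemma avg3_comm (s t : V -> V) : linear s -> linear t ->
  (forall x, s (t x) = t (s x)) -> forall x, avg3 s (avg3 t x) = avg3 t (avg3 s x).
Proof.
move=> s_lin t_lin st x.
have [sZ sD] := GRing.semilinear_linear s_lin.
have [tZ tD] := GRing.semilinear_linear (avg3_linear t_lin).
have stA y : s (avg3 t y) = avg3 t (s y) by rewrite /avg3 sZ !sD !st.
by rewrite {1}/avg3 !stA -!tD -tZ.
Qed.

End AbstractCommutingSquares.

(** * Hilbert space: continuity of the inner product and extension of isometries *)

Section Hilbert.
Variables (C : numClosedFieldType) (H : completeNormedModType C).
Variable dot : {dot H for @Num.conj C}.
Hypothesis dot_norm : forall xi, dot xi xi = `|xi| ^+ 2.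

Lemma dotC xi eta : dot xi eta = (dot eta xi)^*%R.
Proof. by rewrite hermC expr0 mul1r. Qed.

Lemma dot_sqr_comb (c : C) xi eta :
  `|xi + c *: eta| ^+ 2 = `|xi| ^+ 2 + c^*%R * dot xi eta + c * dot eta xi
                         + c * c^*%R * `|eta| ^+ 2.
Proof.
rewrite -!dot_norm linearDl /= !linearDr /= !linearZl_LR !linearZr_LR /=.
by have scE (a b : C) : a *: b = a * b by []; rewrite !scE; ring.
Qed.

Lemma dot_polarization xi eta :
  dot xi eta = 4^-1 * (`|xi + eta| ^+ 2 - `|xi - eta| ^+ 2
    + 'i * `|xi + 'i *: eta| ^+ 2 - 'i * `|xi - 'i *: eta| ^+ 2).
Proof.
have -> : xi + eta = xi + 1 *: eta by rewrite scale1r.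
have -> : xi - eta = xi + (-1) *: eta by rewrite scaleN1r.
have -> : xi - 'i *: eta = xi + (- 'i) *: eta by rewrite scaleNr.
rewrite !dot_sqr_comb !rmorphN !rmorph1 /= !conjCi.
have ii : 'i * 'i = -1 :> C by rewrite -expr2 sqrCi.
by field: ii.
Qed.

(** Polarization writes the inner product as a combination of squared norms, which are
    continuous. *)
Lemma dot_continuous eta : continuous (dot^~ eta).
Proof.
have -> : dot^~ eta = fun xi => 4^-1 * (`|xi + eta| ^+ 2 - `|xi - eta| ^+ 2
    + 'i * `|xi + 'i *: eta| ^+ 2 - 'i * `|xi - 'i *: eta| ^+ 2).
  by apply/funext => xi; exact: dot_polarization.
have sq zeta : continuous (fun xi : H => `|xi + zeta| ^+ 2 : C).
  move=> xi; apply: cvgM; apply: cvg_norm; apply: cvgD => //; exact: cvg_cst.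
move=> xi; apply: cvgM; first exact: cvg_cst.
apply: cvgB; last by apply: cvgM; [exact: cvg_cst|exact: sq].
apply: cvgD; last by apply: cvgM; [exact: cvg_cst|exact: sq].
by apply: cvgB; exact: sq.
Qed.

Section Dense.
Variables (I : Type) (f : I -> H).
Hypothesis f_dense : dense (range f).

(** The filter of indices along which [f] tends to [xi]. It plays the role of an approximating
    sequence, and other families indexed by [I] can be followed along it; density of [f] makes it
    proper. *)
Definition approach (xi : H) : set_system I :=
  filter_from (nbhs xi) (fun B => f @^-1` B).

Lemma approach_filter xi : ProperFilter (approach xi).
Proof.
apply: filter_from_proper.
  apply: filter_from_filter; first by exists setT; exact: filterT.
  by move=> A B nA nB; exists (A `&` B); [exact: filterI|].
move=> A; rewrite nbhsE => -[D [oD Dxi] DA].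
have [|//|z [Dz [i _ iz]]] := @f_dense D _ _; first by exists xi.
by exists i; apply: DA; rewrite iz.
Qed.

Lemma approach_cvg xi : f @ approach xi --> xi.
Proof. by move=> B nB; exists B. Qed.

(** The difference [zeta] is orthogonal to every [f i]; letting [f i] tend to [zeta] gives
    [dot zeta zeta = 0]. *)
Lemma dense_dot_inj xi eta : (forall i, dot xi (f i) = dot eta (f i)) -> xi = eta.
Proof.
move=> xe; apply/eqP; rewrite -subr_eq0; apply/eqP; set zeta := xi - eta.
have fz i : dot (f i) zeta = 0.
  by rewrite dotC /zeta linearBl /= xe subrr rmorph0.
have pF := approach_filter zeta.
have := cvg_comp _ _ (approach_cvg (xi := zeta)) (@dot_continuous zeta zeta).
have -> : dot^~ zeta \o f = cst 0 by apply/funext => i /=.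
move=> lim1; have lim2 : cst (0 : C) @ approach zeta --> (0 : C) by exact: cvg_cst.
have dz : dot zeta zeta = 0 by apply: cvg_unique lim1 lim2; exact: norm_hausdorff.
by move: dz; rewrite dot_norm => /eqP; rewrite expf_eq0 /= normr_eq0 => /eqP.
Qed.

End Dense.

Section IsometryExtension.
Variables (I : Type) (f g : I -> H).
Hypothesis f_dense : dense (range f).
Hypothesis g_dense : dense (range g).
Hypothesis fg : forall i j, dot (g i) (g j) = dot (f i) (f j).

Lemma isometry_dist i j : `|g i - g j| = `|f i - f j|.
Proof.
apply/eqP; rewrite -(@eqrXn2 _ 2) //; apply/eqP.
by rewrite -!dot_norm !linearBl /= !linearBr /= !fg.
Qed.

(** Distances between the [g i] equal those between the [f i], so [g] is Cauchy along a filter on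
    which [f] converges. *)
Lemma isometry_image_cvg xi : cvg (g @ approach f xi).
Proof.
have pF := approach_filter f_dense xi.
apply/cauchy_cvgP/cauchy_exP => e e0.
have [||z [Bz [i0 _ iz]]] := @f_dense (ball xi (e / 2)) _ _.
- by exists xi; apply: ballxx; rewrite divr_gt0.
- exact: ball_open.
exists (g i0); exists (ball xi (e / 2)); first by apply: nbhsx_ballx; rewrite divr_gt0.
move=> i /= Bi; rewrite -iz in Bz.
have := ball_splitr Bz Bi; rewrite -ball_normE /= => lt_e.
by rewrite isometry_dist.
Qed.

(** [U xi] is the limit of [g] along the indices where [f] tends to [xi]. Its pairings with the
    dense family [g] are those of [xi] with [f]; this determines [U xi] and yields linearity. *)
Lemma isometry_extension : exists U : H -> H,
  [/\ linear U, forall xi eta, dot (U xi) (U eta) = dot xi eta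
    & forall i, U (f i) = g i].
Proof.
pose U xi := lim (g @ approach f xi).
have Ug xi : g @ approach f xi --> U xi by exact: isometry_image_cvg.
(* An identity between inner products with [h i] and with [f i] passes to the limit in the first
   argument. It is used twice, first against some [g i], then against some [U eta]. *)
have limE xi a (h : I -> H) (eta zeta : H) : h @ approach f xi --> eta ->
    (forall i, dot (h i) zeta = dot (f i) a) -> dot eta zeta = dot xi a.
  move=> hE hf.
  have pF := approach_filter f_dense xi.
  have l1 := cvg_comp _ _ hE (@dot_continuous zeta eta).
  have l2 := cvg_comp _ _ (approach_cvg f (xi := xi)) (@dot_continuous a xi).
  apply: (cvg_unique _ l1); first exact: norm_hausdorff.
  by have -> : dot^~ zeta \o h = dot^~ a \o f by apply/funext => i /=.
have Uf xi i : dot (U xi) (g i) = dot xi (f i) by apply: limE (Ug xi) _ => j.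
have UU xi eta : dot (U xi) (U eta) = dot xi eta.
  by apply: limE (Ug xi) _ => j; rewrite dotC Uf -dotC.
exists U; split=> //.
  move=> a xi eta; apply: (dense_dot_inj g_dense) => i.
  by rewrite linearDl linearZl_LR /= !Uf linearDl linearZl_LR.
by move=> i; apply: (dense_dot_inj g_dense) => j; rewrite Uf fg.
Qed.

End IsometryExtension.

Lemma isometry_continuous (U : H -> H) : linear U ->
  (forall xi eta, dot (U xi) (U eta) = dot xi eta) -> continuous U.
Proof.
move=> U_lin UU xi.
have UB x y : U (x - y) = U x - U y.
  by rewrite -[x - y]addrC -scaleN1r U_lin scaleN1r addrC.
have UN x : `|U x| = `|x|.
  by apply/eqP; rewrite -(@eqrXn2 _ 2) //; apply/eqP; rewrite -!dot_norm UU.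
apply/cvgrPdist_lt => e e0; near=> y.
rewrite -UB UN; near: y.
exact: (@cvgr_dist_lt _ _ _ _ _ id xi).
Unshelve. all: by end_near. Qed.

End Hilbert.

(** * The strong operator topology as pointwise convergence *)

Lemma lincomb_continuous (K : numFieldType) (W : normedModType K)
    (X : topologicalType) (a : K) (f g : X -> W) :
  continuous f -> continuous g -> continuous (fun x => a *: f x + g x).
Proof. by move=> cf cg x; apply: cvgD; [apply: cvgZr; exact: cf|exact: cg]. Qed.

Section StrongTopology.
Variables (R : realType) (H : gns R).
Implicit Types (S : set (H -> H)) (T : H -> H).

Lemma ptws_continuous (X : topologicalType) (Phi : X -> {ptws H -> H}) :
  (forall xi, continuous (fun t => Phi t xi)) -> continuous Phi.
Proof. by move=> cPhi t; apply/pointwise_cvgP => xi; exact: cPhi. Qed.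

Lemma eval_continuous xi : continuous (fun T : {ptws H -> H} => T xi).
Proof.
move=> T; have := @cvg_id _ (nbhs (T : {ptws H -> H})).
by move=> /pointwise_cvgP /(_ xi).
Qed.

Lemma closure_map (X Y : topologicalType) (A : set X) (B : set Y) (f : X -> Y) :
  continuous f -> (forall x, A x -> B (f x)) ->
  forall x, closure A x -> closure B (f x).
Proof.
move=> cf AB x clx D nD.
by have [y [Ay Dy]] := clx _ (cf x D nD); exists (f y); split; [exact: AB|].
Qed.

(** The closure is taken in one variable at a time. Continuity in the second variable is asked for
    [s] in [A]: composition [s \o t] depends continuously on [t] when [s] itself is continuous. *)
Lemma closure_op2 (X : topologicalType) (A : set X) (op : X -> X -> X) :
  (forall s, A s -> continuous (op s)) -> (forall t, continuous (op^~ t)) ->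
  (forall s t, A s -> A t -> A (op s t)) ->
  forall s t, closure A s -> closure A t -> closure A (op s t).
Proof.
move=> cl cr Aop s t cls clt; apply: closed_closure.
apply: (closure_map (cr t)) cls => s' As'.
by apply: (closure_map (cl s' As')) clt => t' At'; exact: Aop.
Qed.

Lemma closure_agree (X : topologicalType) (A : set X) (f g : X -> H) :
  continuous f -> continuous g -> (forall x, A x -> f x = g x) ->
  forall x, closure A x -> f x = g x.
Proof.
move=> cf cg fg x clx; apply/eqP; rewrite -subr_eq0; apply/eqP.
have cB : continuous (fun y => f y - g y).
  by move=> y; apply: cvgB; [exact: cf|exact: cg].
have : closure [set (0 : H)] (f x - g x).
  by apply: closure_map cB _ _ clx => y /fg ->; rewrite subrr.
have cl0 : closed [set (0 : H)].
  exact/accessible_closed_set1/hausdorff_accessible/norm_hausdorff.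
by move=> /cl0.
Qed.

Lemma comp_ptws_continuous (U U' : H -> H) : continuous U ->
  continuous (fun T : {ptws H -> H} => U \o T \o U' : {ptws H -> H}).
Proof.
move=> cU; apply: ptws_continuous => xi T.
apply: (@cvg_comp _ _ _ (fun T : {ptws H -> H} => T (U' xi)) U); last exact: cU.
exact: eval_continuous.
Qed.

Lemma eval_comp_continuous (X : topologicalType) (F : X -> {ptws H -> H}) xi :
  continuous F -> continuous (fun x => F x xi).
Proof.
move=> cF x; apply: (@cvg_comp _ _ _ F (fun T : {ptws H -> H} => T xi)).
  exact: cF.
exact: eval_continuous.
Qed.

Lemma lincomb_ptws_continuous (a : R[i]) (F G : {ptws H -> H} -> {ptws H -> H}) :
  continuous F -> continuous G ->
  continuous (fun T : {ptws H -> H} => a *: (F T : H -> H) + G T : {ptws H -> H}).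
Proof.
move=> cF cG; apply: ptws_continuous => xi.
have c : continuous (fun T : {ptws H -> H} => a *: F T xi + G T xi).
  by apply: lincomb_continuous; exact: eval_comp_continuous.
exact c.
Qed.

Lemma strong_closure_linear_comb S (a : R[i]) :
  (forall s t, S s -> S t -> S (a *: s + t)) ->
  forall s t, strong_closure S s -> strong_closure S t ->
    strong_closure S (a *: s + t).
Proof.
move=> Slin s t [sl sc cls] [tl tc clt]; split.
- move=> b x y; rewrite !fctE /= sl tl !scalerDr !scalerA [a * b]mulrC.
  by rewrite addrACA.
- exact: lincomb_continuous.
apply: (closure_op2 (op := fun s t : {ptws H -> H} => a *: (s : H -> H) + t)) => //.
  move=> s' Ss'; apply: (lincomb_ptws_continuous (F := fun _ => s') (G := id)).
    exact: cst_continuous.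
  by move=> x; exact: cvg_id.
move=> t'; apply: (lincomb_ptws_continuous (F := id) (G := fun _ => t')).
  by move=> x; exact: cvg_id.
exact: cst_continuous.
Qed.

Lemma strong_closure_comp S : (forall s, S s -> continuous s) ->
  (forall s t, S s -> S t -> S (s \o t)) ->
  forall s t, strong_closure S s -> strong_closure S t -> strong_closure S (s \o t).
Proof.
move=> Sc Scomp s t [sl sc cls] [tl tc clt]; split.
- by move=> b x y /=; rewrite tl sl.
- by move=> x; apply: cvg_comp; [exact: tc|exact: sc].
apply: (closure_op2 (op := fun s t : {ptws H -> H} => s \o t)) => //.
  by move=> s' Ss'; apply: (comp_ptws_continuous (U' := id)); exact: Sc.
by move=> t'; apply: (comp_ptws_continuous (U := id)) => x; exact: cvg_id.
Qed.

End StrongTopology.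

(** * Conjugation by unitaries and the tower of tensor products W_k *)

Section Adjoint.
Variable C : numClosedFieldType.

Lemma adjmxM m n p (x : 'M[C]_(m, n)) (y : 'M[C]_(n, p)) :
  (x *m y)^t* = y^t* *m x^t*.
Proof. by rewrite trmx_mul map_mxM. Qed.

Lemma adjmx1 n : (1%:M : 'M[C]_n)^t* = 1%:M.
Proof. by rewrite trmx1 map_mx1. Qed.

Lemma adjmx_tens m n p q (x : 'M[C]_(m, n)) (y : 'M[C]_(p, q)) :
  (x *t y)^t* = x^t* *t y^t*.
Proof. by rewrite trmx_tens map_mxT. Qed.

Lemma Ad_tens m n (a x : 'M[C]_m) (b y : 'M[C]_n) :
  Ad (a *t b) (x *t y) = Ad a x *t Ad b y.
Proof. by rewrite /Ad adjmx_tens !tensmx_mul. Qed.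

Lemma Ad_linear n (w : 'M[C]_n) : linear (Ad w).
Proof. by move=> a x y; rewrite /Ad mulmxDr mulmxDl -scalemxAr -scalemxAl. Qed.

Lemma Ad_Ad n (w z x : 'M[C]_n) : Ad w (Ad z x) = Ad (w *m z) x.
Proof. by rewrite /Ad adjmxM !mulmxA. Qed.

Lemma Ad_adj n (w x : 'M[C]_n) : (Ad w x)^t* = Ad w (x^t*).
Proof. by rewrite /Ad !adjmxM trmxCK mulmxA. Qed.

Lemma Ad_one n (x : 'M[C]_n) : Ad 1%:M x = x.
Proof. by rewrite /Ad adjmx1 mul1mx mulmx1. Qed.

Section Unitary.
Variables (n : nat) (w : 'M[C]_n).
Hypothesis ww : w *m w^t* = 1%:M.

Lemma Ad_mul x y : Ad w (x *m y) = Ad w x *m Ad w y.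
Proof.
by rewrite /Ad !mulmxA -(mulmxA (w *m x) (w^t*) w) (mulmx1C ww) mulmx1.
Qed.

Lemma Ad_unit : Ad w 1%:M = 1%:M.
Proof. by rewrite /Ad mulmx1. Qed.

Lemma Ad_trace x : \tr (Ad w x) = \tr x.
Proof. by rewrite /Ad mxtrace_mulC mulmxA (mulmx1C ww) mul1mx. Qed.

Lemma Ad_fixedP x : Ad w x = x <-> w *m x = x *m w.
Proof.
split=> [{2}<-|wx]; first by rewrite /Ad -!mulmxA (mulmx1C ww) mulmx1.
by rewrite /Ad wx -mulmxA ww mulmx1.
Qed.

End Unitary.

Section Order3.
Variables (n : nat) (w : 'M[C]_n).
Hypothesis www : w *m w *m w = 1%:M.

Lemma Ad3 x : Ad w (Ad w (Ad w x)) = x.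
Proof. by rewrite !Ad_Ad www Ad_one. Qed.

End Order3.

Section ShiftTower.
Variables s t : 'M[C]_3.

(** [t] occupies the innermost place, so that going up one level only adds a factor [s] on the left,
    which acts trivially on [1 *t x]. The factor of size 1 makes the dimensions agree by
    computation. *)
Fixpoint shift_tower (k : nat) : 'M[C]_(dim3 k.+1) :=
  if k is j.+1 return 'M[C]_(dim3 k.+1) then s *t shift_tower j
  else t *t (1%:M : 'M[C]_(dim3 0)).

Lemma tens11 m n : (1%:M : 'M[C]_m) *t (1%:M : 'M[C]_n) = 1%:M.
Proof.
apply/matrixP => i j; case: (mxtens_indexP i) => i1 i2; case: (mxtens_indexP j) => j1 j2.
rewrite tensmxE !mxE (can_eq (@mxtens_indexK m n)) xpair_eqE.
by rewrite -natrM mulnb.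
Qed.

Lemma shift_tower_unitary : s *m s^t* = 1%:M -> t *m t^t* = 1%:M ->
  forall k, shift_tower k *m (shift_tower k)^t* = 1%:M.
Proof.
move=> ss tt; elim=> [|k IHk].
  by rewrite /= adjmx_tens tensmx_mul tt adjmx1 mulmx1 tens11.
by rewrite [shift_tower _]/= adjmx_tens tensmx_mul ss IHk tens11.
Qed.

Lemma shift_tower3 : s *m s *m s = 1%:M -> t *m t *m t = 1%:M ->
  forall k, shift_tower k *m shift_tower k *m shift_tower k = 1%:M.
Proof.
move=> ss tt; elim=> [|k IHk].
  by rewrite /= !tensmx_mul tt !mulmx1 tens11.
by rewrite [shift_tower _]/= !tensmx_mul ss IHk tens11.
Qed.

Lemma Ad_shift_tower_compat : s *m s^t* = 1%:M -> forall k x,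
  Ad (shift_tower k.+1) ((1%:M : 'M[C]_3) *t x) = 1%:M *t Ad (shift_tower k) x.
Proof. by move=> ss k x; rewrite [shift_tower _]/= Ad_tens Ad_unit. Qed.

End ShiftTower.

End Adjoint.

(** * The automorphisms Ad W_k are implemented by one unitary of the GNS space *)

Section GNS.
Variables (R : realType) (H : gns R).
Local Notation rep := (@gns_rep R H _).
Local Notation dot := (gns_dot H).
Local Notation vec := (gns_vec H).

Definition gns_alg : set (H -> H) :=
  [set T | exists k (x : 'M[R[i]]_(dim3 k.+1)), T = rep x].

(** Each odd algebra is contained in the full matrix algebra of the next even level. *)
Lemma hyperfinite_factorE : hyperfinite_factor H = strong_closure gns_alg.
Proof.
congr strong_closure; apply/seteqP; split=> [T [k _ []]|T [k [x ->]]].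
- by move=> [x _ <-]; exists k, x.
- by move=> [x _ <-]; exists k.+1, x.
by exists k => //; left; exists x.
Qed.

Definition pad k (x : 'M[R[i]]_(dim3 k.+1)) : 'M[R[i]]_(dim3 k.+2) :=
  (1%:M : 'M[R[i]]_3) *t x.

(** Elements of different levels are compared at a common one. Padding by [1 *t _] changes neither
    the operator nor the action of the shift towers, and the same [y] serves for all [s] and [t]. *)
Lemma rep_raise k m (x : 'M[R[i]]_(dim3 k.+1)) : (k <= m)%N ->
  exists y : 'M[R[i]]_(dim3 m.+1), rep y = rep x /\
    forall s t : 'M[R[i]]_3, s *m s^t* = 1%:M ->
      rep (Ad (shift_tower s t m) y) = rep (Ad (shift_tower s t k) x).
Proof.
elim: m => [|m IHm].
  by rewrite leqn0 => /eqP k0; subst k; exists x.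
rewrite leq_eqVlt ltnS => /orP[/eqP km|/IHm[y [yx yAd]]].
  by subst k; exists x.
exists (pad y); split; first by rewrite gns_rep_compat.
move=> s t ss; rewrite -yAd //.
by rewrite (Ad_shift_tower_compat t ss) gns_rep_compat.
Qed.

Lemma gns_alg_linear (a : R[i]) S T :
  gns_alg S -> gns_alg T -> gns_alg (a *: S + T).
Proof.
move=> [k [x ->]] [l [y ->]].
have [x' [<- _]] := rep_raise x (leq_maxl k l).
have [y' [<- _]] := rep_raise y (leq_maxr k l).
exists (maxn k l), (a *: x' + y'); apply/funext => xi.
by rewrite gns_repP.
Qed.

Lemma gns_alg_comp S T : gns_alg S -> gns_alg T -> gns_alg (S \o T).
Proof.
move=> [k [x ->]] [l [y ->]].
have [x' [<- _]] := rep_raise x (leq_maxl k l).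
have [y' [<- _]] := rep_raise y (leq_maxr k l).
exists (maxn k l), (x' *m y'); apply/funext => xi.
by rewrite gns_repM.
Qed.

Lemma gns_alg_continuous T : gns_alg T -> continuous T.
Proof. by move=> [k [x ->]]; exact: gns_rep_continuous. Qed.

Lemma hyperfinite_linear_comb (a : R[i]) S T : hyperfinite_factor H S ->
  hyperfinite_factor H T -> hyperfinite_factor H (a *: S + T).
Proof.
rewrite hyperfinite_factorE.
by apply: strong_closure_linear_comb => S' T'; exact: gns_alg_linear.
Qed.

Lemma hyperfinite_comp S T : hyperfinite_factor H S ->
  hyperfinite_factor H T -> hyperfinite_factor H (S \o T).
Proof.
rewrite hyperfinite_factorE; apply: strong_closure_comp.
  exact: gns_alg_continuous.
by move=> S' T'; exact: gns_alg_comp.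
Qed.

Lemma rep_hyperfinite k (x : 'M[R[i]]_(dim3 k.+1)) : hyperfinite_factor H (rep x).
Proof.
rewrite hyperfinite_factorE; split.
- exact: gns_rep_linear.
- exact: gns_rep_continuous.
by apply: subset_closure; exists k, x.
Qed.

Lemma gns_dot_rep k (x y : 'M[R[i]]_(dim3 k.+1)) :
  dot (rep x vec) (rep y vec) = ntrace (y^t* *m x).
Proof. by rewrite -(@gns_state R H k) gns_repM [RHS]gns_rep_adj trmxCK. Qed.

Definition gns_index := {k : nat & 'M[R[i]]_(dim3 k.+1)}.
Definition gns_family (p : gns_index) : H := rep (projT2 p) vec.

Lemma gns_family_dense : dense (range gns_family).
Proof.
have -> : range gns_family = [set xi | exists k (x : 'M[R[i]]_(dim3 k.+1)), xi = rep x vec].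
  apply/seteqP; split=> [xi [[k x] _ <-]|xi [k [x ->]]]; first by exists k, x.
  by exists (existT _ k x).
exact: gns_cyclic.
Qed.

Lemma gns_inj xi eta :
  (forall k (x : 'M[R[i]]_(dim3 k.+1)), dot xi (rep x vec) = dot eta (rep x vec)) ->
  xi = eta.
Proof.
by move=> xe; apply: (dense_dot_inj (@gns_norm R H) gns_family_dense) => -[k x]; exact: xe.
Qed.

Section Shift.
Variables s t : 'M[R[i]]_3.
Hypothesis ss : s *m s^t* = 1%:M.
Hypothesis tt : t *m t^t* = 1%:M.
Hypothesis s3 : s *m s *m s = 1%:M.
Hypothesis t3 : t *m t *m t = 1%:M.
Local Notation W := (shift_tower s t).

Let WW k : W k *m (W k)^t* = 1%:M.
Proof. exact: shift_tower_unitary. Qed.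

Let W3 k : W k *m W k *m W k = 1%:M.
Proof. exact: shift_tower3. Qed.

(* [U] implements on [H] the automorphism of the factor that extends all
   [Ad (W k)]. *)
Definition implements (U : H -> H) : Prop :=
  [/\ linear U, forall xi eta, dot (U xi) (U eta) = dot xi eta,
      forall xi, U (U (U xi)) = xi, U vec = vec &
      forall k (x : 'M[R[i]]_(dim3 k.+1)) xi, U (rep x xi) = rep (Ad (W k) x) (U xi)].

(** [Ad (W k)] is a trace-preserving *-automorphism, so sending [rep x vec] to
    [rep (Ad (W k) x) vec] preserves inner products; it is compatible across levels and extends from
    the dense set of these vectors. *)
Lemma shift_implemented : exists U, implements U.
Proof.
pose g (p : gns_index) := rep (Ad (W (projT1 p)) (projT2 p)) vec.
(* [Ad (W k)] is onto, with its own square as inverse, so [g] has the same range as the original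
   family. *)
have g_dense : dense (range g).
  have -> : range g = range gns_family; last exact: gns_family_dense.
  apply/seteqP; split=> [_ [[k x] _ <-]|_ [[k x] _ <-]].
    by exists (existT _ k (Ad (W k) x)).
  exists (existT _ k (Ad (W k) (Ad (W k) x))) => //.
  by rewrite /g /gns_family /= (Ad3 (W3 k)).
have rep_common (p q : gns_index) : exists m (x y : 'M[R[i]]_(dim3 m.+1)),
    [/\ gns_family p = rep x vec, gns_family q = rep y vec,
        g p = rep (Ad (W m) x) vec & g q = rep (Ad (W m) y) vec].
  move: p q => [k x] [l y]; exists (maxn k l).
  have [x' [xE xW]] := rep_raise x (leq_maxl k l).
  have [y' [yE yW]] := rep_raise y (leq_maxr k l).
  by exists x', y'; rewrite /g /gns_family /= xE yE xW // yW.
have fg p q : dot (g p) (g q) = dot (gns_family p) (gns_family q).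
  have [m [x [y [-> -> -> ->]]]] := rep_common p q.
  rewrite !gns_dot_rep Ad_adj.
  by rewrite -(Ad_mul (WW m)) /ntrace (Ad_trace (WW m)).
have [U [U_lin UU Uf]] :=
  isometry_extension (@gns_norm R H) gns_family_dense g_dense fg.
have Uvec k (x : 'M[R[i]]_(dim3 k.+1)) : U (rep x vec) = rep (Ad (W k) x) vec.
  exact: (Uf (existT _ k x)).
exists U; split=> //.
- move=> xi; apply: gns_inj => k x.
  have -> : rep x vec = U (U (U (rep x vec))) by rewrite !Uvec (Ad3 (W3 k)).
  by rewrite !UU !Uvec (Ad3 (W3 k)).
- by rewrite -{1}(@gns_rep1 R H 0 vec) Uvec (Ad_unit (WW 0)) gns_rep1.
move=> k x xi.
have U_repM (z : 'M[R[i]]_(dim3 k.+1)) l (y : 'M[R[i]]_(dim3 l.+1)) :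
    U (rep z (rep y vec)) = rep (Ad (W k) z) (U (rep y vec)).
  have [z' [<- zW]] := rep_raise z (leq_maxl k l).
  have [y' [<- _]] := rep_raise y (leq_maxr k l).
  by rewrite -zW // -gns_repM !Uvec (Ad_mul (WW _)) gns_repM.
(* The covariance is known so far on the dense vectors. Taking the adjoint moves [x] from the
   arbitrary [xi] to such a vector, and [U] then cancels as an isometry. *)
apply: (dense_dot_inj (@gns_norm R H) g_dense) => -[l y].
rewrite -(Uf (existT _ l y)) UU [RHS]gns_rep_adj Ad_adj -U_repM UU.
by rewrite gns_rep_adj.
Qed.

End Shift.
End GNS.

(** * The fixed point algebra in R and the conditional expectation onto it *)

Lemma scale_sum3_continuous (K : numFieldType) (W : normedModType K)
    (X : topologicalType) (a : K) (f g h : X -> W) :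
  continuous f -> continuous g -> continuous h ->
  continuous (fun x => a *: (f x + g x + h x)).
Proof.
move=> cf cg ch x; apply: cvgZr.
by apply: cvgD; [apply: cvgD; [exact: cf|exact: cg]|exact: ch].
Qed.

Section FixedFactor.
Variables (R : realType) (H : gns R).
Local Notation rep := (@gns_rep R H _).
Local Notation dot := (gns_dot H).
Local Notation vec := (gns_vec H).

(* [U \o U] is the inverse of [U] for [U] of order 3. *)
Definition conj_op (U T : H -> H) : H -> H := U \o T \o (U \o U).

(** Built level by level from fixed matrices, the form that matches [hadamard_subfactor];
    [fixed_factorE] identifies it with the operators of R fixed by the extended automorphism. *)
Definition fixed_factor (s t : 'M[R[i]]_3) : set (H -> H) :=
  strong_closure (\bigcup_k
    (@gns_rep R H k @` [set x | Ad (shift_tower s t k) x = x])).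

Section OneShift.
Variables s t : 'M[R[i]]_3.
Hypothesis ss : s *m s^t* = 1%:M.
Hypothesis tt : t *m t^t* = 1%:M.
Hypothesis s3 : s *m s *m s = 1%:M.
Hypothesis t3 : t *m t *m t = 1%:M.
Local Notation W := (shift_tower s t).

Let WW k : W k *m (W k)^t* = 1%:M.
Proof. exact: shift_tower_unitary. Qed.

Let W3 k : W k *m W k *m W k = 1%:M.
Proof. exact: shift_tower3. Qed.

Variable U : H -> H.
Hypothesis UW : implements s t U.

Lemma implements_continuous : continuous U.
Proof.
case: UW => U_lin UU _ _ _.
exact: (isometry_continuous (@gns_norm R H) U_lin UU).
Qed.

Lemma conj_op_linear : linear (conj_op U).
Proof.
case: UW => U_lin _ _ _ _ a x y; apply/funext => xi.
by rewrite /conj_op /= !fctE U_lin.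
Qed.

Lemma conj_op_rep k (x : 'M[R[i]]_(dim3 k.+1)) :
  conj_op U (rep x) = rep (Ad (W k) x).
Proof.
case: UW => _ _ U3 _ Urep; apply/funext => xi.
by rewrite /conj_op /= Urep U3.
Qed.

Lemma conj_opM S T : conj_op U (S \o T) = conj_op U S \o conj_op U T.
Proof.
case: UW => _ _ U3 _ _; apply/funext => xi.
by rewrite /conj_op /= U3.
Qed.

Lemma conj_op3 T : conj_op U (conj_op U (conj_op U T)) = T.
Proof.
case: UW => _ _ U3 _ _; apply/funext => xi.
by rewrite /conj_op /= !U3.
Qed.

Lemma conj_op_pos T : op_pos T -> op_pos (conj_op U T).
Proof.
case: UW => _ UU U3 _ _ posT xi.
rewrite /conj_op /= -{2}(U3 xi) UU; exact: posT.
Qed.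

Lemma conj_op_trace T : op_trace (conj_op U T) = op_trace T.
Proof.
case: UW => _ UU _ Uvec _.
by rewrite /op_trace /conj_op /= !Uvec -[X in dot (U _) X]Uvec UU.
Qed.

Lemma conj_op_continuous : continuous (conj_op U : {ptws H -> H} -> {ptws H -> H}).
Proof. by apply: comp_ptws_continuous; exact: implements_continuous. Qed.

Lemma hyperfinite_conj_op T : hyperfinite_factor H T ->
  hyperfinite_factor H (conj_op U T).
Proof.
rewrite hyperfinite_factorE => -[Tl Tc clT].
case: (UW) => Ul _ _ _ _; split.
- by move=> a x y; rewrite /conj_op /= !Ul Tl Ul.
- move=> x; have Uc := implements_continuous.
  have cc (f g : H -> H) : continuous f -> continuous g -> continuous (g \o f).
    by move=> cf cg y; apply: continuous_comp; [exact: cf|exact: cg].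
  exact: (cc _ _ (cc _ _ Uc Uc) (cc _ _ Tc Uc)).
apply: (closure_map conj_op_continuous) clT => _ [k [x ->]].
by exists k, (Ad (W k) x); exact: conj_op_rep.
Qed.

Lemma conj_op_cond_exp :
  trace_preserving_cond_exp (fun S T : H -> H => S \o T) (@op_pos R H)
    (@op_trace R H) (hyperfinite_factor H)
    (hyperfinite_factor H `&` [set T | conj_op U T = T]) (avg3 (conj_op U)).
Proof.
apply: avg3_cond_exp.
- exact: conj_op_linear.
- exact: hyperfinite_linear_comb.
- exact: hyperfinite_conj_op.
- exact: conj_opM.
- exact: conj_op3.
- exact: conj_op_pos.
- exact: conj_op_trace.
- move=> S T posS posT xi; rewrite /= linearDl /=.
  by apply: addr_ge0; [exact: posS|exact: posT].
- move=> a T a0 posT xi; rewrite /= linearZl_LR /=.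
  by apply: mulr_ge0 => //; exact: posT.
- by move=> T a x y; apply/funext.
- move=> T [Tl _ _] a x y; apply/funext => xi /=; exact: Tl.
- by move=> a x y; rewrite /op_trace /= linearDl linearZl_LR.
Qed.

Lemma avg3_conj_op_rep k (x : 'M[R[i]]_(dim3 k.+1)) :
  avg3 (conj_op U) (rep x) = rep (avg3 (Ad (W k)) x).
Proof.
apply/funext => xi; rewrite /avg3 !conj_op_rep.
have rep_lin : linear (fun y : 'M[R[i]]_(dim3 k.+1) => rep y xi).
  by move=> a y z; exact: gns_repP.
have [repZ repD] := GRing.semilinear_linear rep_lin.
by rewrite repZ !repD.
Qed.

(** Being fixed is a strongly closed condition, which gives one inclusion. The other holds because
    the average is strongly continuous and sends each matrix to a fixed matrix of the same level. *)
Lemma fixed_factorE :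
  fixed_factor s t = hyperfinite_factor H `&` [set T | conj_op U T = T].
Proof.
apply/seteqP; split=> [T|T [MT /= TU]].
  move=> [Tl Tc clT]; split.
    rewrite hyperfinite_factorE; split=> //; apply: closureS clT.
    by move=> _ [k _ [x _ <-]]; exists k, x.
  apply/funext => xi /=.
  apply: (@closure_agree R H {ptws H -> H} _ (fun T => conj_op U T xi)
            (fun T => T xi) _ _ _ _ clT).
  - apply: eval_comp_continuous; exact: conj_op_continuous.
  - exact: eval_continuous.
  - by move=> _ [k _ [x /= xW <-]]; rewrite conj_op_rep xW.
move: (MT); rewrite hyperfinite_factorE => -[Tl Tc clT]; split=> //.
(* A fixed [T] is its own average, so matrices approximating [T] may be replaced by their
   averages. *)
rewrite -(avg3_fixed TU).
have avg_c : continuous (avg3 (conj_op U) : {ptws H -> H} -> {ptws H -> H}).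
  have c2 : continuous (fun T : {ptws H -> H} =>
      conj_op U (conj_op U T) : {ptws H -> H}).
    move=> S; apply: (@cvg_comp _ _ _ (conj_op U : {ptws H -> H} -> {ptws H -> H})
                                      (conj_op U : {ptws H -> H} -> {ptws H -> H})).
      exact: conj_op_continuous.
    exact: conj_op_continuous.
  apply: ptws_continuous => xi.
  have c : continuous (fun T : {ptws H -> H} =>
      3^-1 *: (T xi + conj_op U T xi + conj_op U (conj_op U T) xi)).
    apply: scale_sum3_continuous.
    - exact: eval_continuous.
    - apply: eval_comp_continuous; exact: conj_op_continuous.
    - exact: (eval_comp_continuous (xi := xi) c2).
  exact c.
apply: (closure_map avg_c) clT => _ [k [x ->]].
have Wlin := @Ad_linear _ _ (W k).
exists k => //; exists (avg3 (Ad (W k)) x).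
  exact: (theta_avg3 Wlin (Ad3 (W3 k) x)).
by rewrite avg3_conj_op_rep.
Qed.

End OneShift.
End FixedFactor.

(** * Block diagonal matrices and the cyclic shift *)

Section BlockDiagonal.
Variable C : numClosedFieldType.

(** The block diagonal matrix with blocks [x i]; the elements of [Delta_tens] are exactly these. *)
Definition dsum n (x : 'I_3 -> 'M[C]_n) : 'M[C]_(3 * n) :=
  \sum_i delta_mx i i *t x i.

Lemma dsumE n (x : 'I_3 -> 'M[C]_n) i j a b :
  dsum x (mxtens_index (i, a)) (mxtens_index (j, b)) = x i a b *+ (i == j).
Proof.
rewrite summxE (bigD1 i) //= tensmxE mxE eqxx /= [j == i]eq_sym big1 => [|l li].
  by rewrite addr0 mulr_natl.
by rewrite tensmxE mxE [i == l]eq_sym (negPf li) mul0r.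
Qed.

Lemma delta_diagM m (i j : 'I_m) :
  delta_mx i i *m delta_mx j j = delta_mx i i *+ (i == j) :> 'M[C]_m.
Proof.
case: (eqVneq i j) => [->|ij]; first by rewrite mul_delta_mx.
by rewrite mul_delta_mx_0.
Qed.

Lemma dsumM n (x y : 'I_3 -> 'M[C]_n) :
  dsum x *m dsum y = dsum (fun i => x i *m y i).
Proof.
rewrite mulmx_suml; apply: eq_bigr => i _.
rewrite mulmx_sumr (bigD1 i) //= tensmx_mul delta_diagM eqxx big1 ?addr0 // => j ji.
by rewrite tensmx_mul delta_diagM eq_sym (negPf ji) tens0mx.
Qed.

Lemma dsum_adj n (x : 'I_3 -> 'M[C]_n) : (dsum x)^t* = dsum (fun i => (x i)^t*).
Proof.
rewrite linear_sum /= map_mx_sum; apply: eq_bigr => i _.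
by rewrite adjmx_tens trmx_delta map_delta_mx.
Qed.

Lemma delta_sum1 : \sum_i delta_mx i i = 1%:M :> 'M[C]_3.
Proof.
apply/matrixP => i j; rewrite summxE (bigD1 i) //= big1 ?addr0; last first.
  by move=> l li; rewrite mxE [i == l]eq_sym (negPf li).
by rewrite !mxE eqxx /= eq_sym.
Qed.

Lemma tensmx_suml m n (x : 'I_3 -> 'M[C]_m) (y : 'M[C]_n) :
  (\sum_i x i) *t y = \sum_i x i *t y.
Proof.
apply/matrixP => i j; case: (mxtens_indexP i) => i1 i2.
case: (mxtens_indexP j) => j1 j2.
by rewrite tensmxE !summxE mulr_suml; apply: eq_bigr => l _; rewrite tensmxE.
Qed.

Lemma dsum_const n (y : 'M[C]_n) : dsum (fun=> y) = 1%:M *t y.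
Proof. by rewrite -delta_sum1 tensmx_suml. Qed.

Lemma tens_diag n (d : 'rV[C]_3) (y : 'M[C]_n) :
  diag_mx d *t y = dsum (fun i => d 0 i *: y).
Proof.
apply/matrixP => i j; case: (mxtens_indexP i) => i1 i2.
case: (mxtens_indexP j) => j1 j2.
by rewrite tensmxE dsumE !mxE -mulrnAl.
Qed.

(** Addition in ['I_3] is modulo 3: this is the permutation matrix S taking the basis vector e_j to
    e_(j+1). *)
Definition cshift : 'M[C]_3 := \matrix_(i, j) (i == j + 1)%:R.

Lemma cshift_dsum n (x : 'I_3 -> 'M[C]_n) :
  (cshift *t 1%:M) *m dsum x = dsum (fun i => x (i - 1)) *m (cshift *t 1%:M).
Proof.
rewrite mulmx_sumr mulmx_suml [RHS](reindex_inj (addIr 1)) /=.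
apply: eq_bigr => i _; rewrite !tensmx_mul mul1mx mulmx1 addrK; congr (_ *t _).
apply/matrixP => a b; rewrite !mxE.
rewrite (bigD1 i) //= big1 ?addr0 => [|l li]; last first.
  by rewrite !mxE (negPf li) mulr0.
rewrite (bigD1 (i + 1)) //= big1 ?addr0 => [|l li]; last first.
  by rewrite !mxE (negPf li) andbF mul0r.
rewrite !mxE !eqxx /= andbT -!natrM !mulnb (inj_eq (addIr 1)) eq_sym.
by rewrite [i == b]eq_sym.
Qed.

(** The block of [x] at (i, j) is multiplied by [z 0 i] on one side and by [z 0 j] on the other, so
    it vanishes off the diagonal. *)
Lemma dsum_commute n (z : 'rV[C]_3) (x : 'M[C]_(3 * n)) :
  (forall i j, z 0 i = z 0 j -> i = j) ->
  (diag_mx z *t 1%:M) *m x = x *m (diag_mx z *t 1%:M) ->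
  exists y, x = dsum y.
Proof.
move=> z_inj zx.
exists (fun i => \matrix_(a, b) x (mxtens_index (i, a)) (mxtens_index (i, b))).
apply/matrixP => p q; case: (mxtens_indexP p) => i a.
case: (mxtens_indexP q) => j b; rewrite dsumE mxE.
case: (eqVneq i j) => [->//|ij].
have zE : (diag_mx z *t 1%:M : 'M[C]_(3 * n)) =
    diag_mx (\row_k z 0 (mxtens_unindex k).1).
  apply/matrixP => k l; case: (mxtens_indexP k) => k1 k2.
  case: (mxtens_indexP l) => l1 l2; rewrite tensmxE !mxE mxtens_indexK /=.
  rewrite (can_eq (@mxtens_indexK 3 n)) xpair_eqE.
  by case: eqP; case: eqP; rewrite /= ?mulr1n ?mulr0n ?mulr1 ?mulr0 ?mul0r.
have := congr1 (fun m : 'M[C]_(3 * n) => m (mxtens_index (i, a)) (mxtens_index (j, b))) zx.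
rewrite zE mul_diag_mx mul_mx_diag !mxE !mxtens_indexK /= [RHS]mulrC => /eqP.
rewrite -subr_eq0 -mulrBl mulf_eq0 subr_eq0 => /orP[/eqP /z_inj ij'|/eqP-> //].
by rewrite ij' eqxx in ij.
Qed.

End BlockDiagonal.

(** * The algebras B^u_(2k) as fixed point algebras *)

Section HadamardTower.
Variable C : numClosedFieldType.

Lemma tensmx_sumr m n (x : 'M[C]_m) (y : 'I_3 -> 'M[C]_n) :
  x *t (\sum_i y i) = \sum_i x *t y i.
Proof.
apply/matrixP => i j; case: (mxtens_indexP i) => i1 i2.
case: (mxtens_indexP j) => j1 j2.
by rewrite tensmxE !summxE mulr_sumr; apply: eq_bigr => l _; rewrite tensmxE.
Qed.

Lemma tensmx_linearl m n (y : 'M[C]_n) : linear (fun x : 'M[C]_m => x *t y).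
Proof.
move=> a x x'; apply/matrixP => i j; case: (mxtens_indexP i) => i1 i2.
case: (mxtens_indexP j) => j1 j2.
rewrite tensmxE [X in X * _]mxE [X in X + _]mxE [RHS]mxE [X in _ = X + _]mxE !tensmxE.
by rewrite mulrDl mulrA.
Qed.

Lemma tensmxZr m n (a : C) (x : 'M[C]_m) (y : 'M[C]_n) :
  x *t (a *: y) = a *: (x *t y).
Proof.
apply/matrixP => i j; case: (mxtens_indexP i) => i1 i2.
case: (mxtens_indexP j) => j1 j2.
by rewrite [RHS]mxE !tensmxE mxE mulrCA.
Qed.

(** Here [W = w Z w^*], so conjugation by [w] carries the commutant of [Z], which is [D], onto the
    commutant of [W]. *)
Lemma Ad_image_fixed n (w W Z : 'M[C]_n) (D : set 'M[C]_n) :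
  w *m w^t* = 1%:M -> W *m W^t* = 1%:M -> W *m w = w *m Z ->
  (forall x, D x <-> Z *m x = x *m Z) ->
  Ad w @` D = [set x | Ad W x = x].
Proof.
move=> ww WW Ww DZ; have ww' := mulmx1C ww.
have WE : W = w *m Z *m w^t* by rewrite -Ww -mulmxA ww mulmx1.
apply/seteqP; split=> [_ [y /DZ yZ <-]|x /= /(Ad_fixedP WW) xW].
  apply/(Ad_fixedP WW); rewrite WE /Ad !mulmxA -(mulmxA _ (w^t*) w) ww' mulmx1.
  by rewrite -(mulmxA _ (w^t*) w) ww' mulmx1 -!(mulmxA w) yZ.
exists (Ad (w^t*) x); last by rewrite Ad_Ad ww Ad_one.
apply/DZ; rewrite /Ad trmxCK.
have -> : Z = w^t* *m W *m w by rewrite -mulmxA Ww mulmxA ww' mul1mx.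
rewrite !mulmxA -(mulmxA _ w (w^t*)) ww mulmx1 -(mulmxA _ w (w^t*)) ww mulmx1.
by rewrite -!(mulmxA (w^t*)) xW.
Qed.

Lemma Delta3P (d : 'rV[C]_3) (x : 'M[C]_3) : (forall i j, d 0 i = d 0 j -> i = j) ->
  Delta3 C x <-> diag_mx d *m x = x *m diag_mx d.
Proof.
move=> d_inj; split=> [/is_diag_mxP xd|dx]; last first.
  apply/is_diag_mxP => i j ij; apply/eqP; move: ij; apply: contraNT => xij.
  have := congr1 (fun m : 'M[C]_3 => m i j) dx.
  rewrite mul_diag_mx mul_mx_diag !mxE mulrC => /(mulfI xij) /d_inj ->.
  exact: eqxx.
apply/matrixP => i j; rewrite mul_diag_mx mul_mx_diag !mxE mulrC.
case: (eqVneq i j) => [->//|ij].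
by rewrite xd ?mul0r // -(inj_eq val_inj).
Qed.

Variables (u : 'M[C]_3) (z g : 'rV[C]_3).

(** For g_i = gam_i conj(gam_(i-1)) this is T_u = diag(gam) S diag(gam)^*. *)
Definition phase_shift (g : 'rV[C]_3) : 'M[C]_3 := diag_mx g *m cshift C.

Hypothesis u_unitary : u *m u^t* = 1%:M.
Hypothesis u_mod : forall i j, 3 * (u i j * (u i j)^*%R) = 1.
Hypothesis z_inj : forall i j, z 0 i = z 0 j -> i = j.
Hypothesis z_mod : forall j, z 0 j * (z 0 j)^*%R = 1.
Hypothesis g_mod : forall i, g 0 i * (g 0 i)^*%R = 1.
Hypothesis u_shift : forall i j, g 0 (i + 1) * u i j = u (i + 1) j * z 0 j.

(** The diagonal of the i-th block of D_u; its entries have modulus 1 because [u] is Hadamard. *)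
Definition conj_row (i : 'I_3) : 'rV[C]_3 := \row_j (sqrtC 3 * (u i j)^*%R).

Lemma D_tensE k : D_tens u k = dsum (fun i => diag_mx (conj_row i) *t (1%:M : 'M[C]_(dim3 k))).
Proof.
rewrite /D_tens scaler_sumr; apply: eq_bigr => i _.
rewrite tens_diag tensmx_sumr scaler_sumr; apply: eq_bigr => j _.
by rewrite !tensmxZr mxE scalerA.
Qed.

Lemma conj_row_mod i j : conj_row i 0 j * (conj_row i 0 j)^*%R = 1.
Proof.
have s3 : (sqrtC (3 : C))^*%R = sqrtC 3 by apply: geC0_conj; rewrite sqrtC_ge0 ler0n.
rewrite mxE rmorphM /= conjCK s3.
by rewrite mulrACA -expr2 sqrtCK [_ * u i j]mulrC u_mod.
Qed.

Lemma diag_unitary (d : 'rV[C]_3) : (forall i, d 0 i * (d 0 i)^*%R = 1) ->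
  diag_mx d *m (diag_mx d)^t* = 1%:M.
Proof.
move=> d_mod; apply/matrixP => i j; rewrite mul_diag_mx !mxE eq_sym.
by case: (eqVneq i j) => [->|_]; rewrite ?mulr1n ?d_mod // mulr0n rmorph0 mulr0.
Qed.

Lemma D_tens_unitary k : D_tens u k *m (D_tens u k)^t* = 1%:M.
Proof.
rewrite D_tensE dsum_adj dsumM -[RHS](tens11 C 3) -dsum_const.
congr dsum; apply/funext => i.
by rewrite adjmx_tens tensmx_mul adjmx1 mulmx1 diag_unitary ?tens11 //; exact: conj_row_mod.
Qed.

Lemma cshift_unitary : cshift C *m (cshift C)^t* = 1%:M.
Proof.
apply/matrixP => i j; rewrite !mxE (bigD1 (i - 1)) //= big1 ?addr0 => [|l li].
  by rewrite !mxE subrK eqxx mul1r rmorph_nat eq_sym.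
rewrite !mxE; case: eqP => [il|_]; last by rewrite mul0r.
by rewrite il addrK eqxx in li.
Qed.

Lemma phase_shift_unitary : phase_shift g *m (phase_shift g)^t* = 1%:M.
Proof.
rewrite adjmxM mulmxA -(mulmxA (diag_mx g)) cshift_unitary mulmx1.
exact: diag_unitary.
Qed.

Lemma phase_shift_u : phase_shift g *m u = u *m diag_mx z.
Proof.
apply/matrixP => i j; rewrite -mulmxA mul_diag_mx mul_mx_diag !mxE.
rewrite (bigD1 (i - 1)) //= big1 ?addr0 => [|l li].
  by rewrite mxE subrK eqxx mul1r -{1}(subrK 1 i) u_shift subrK.
rewrite !mxE; case: eqP => [il|_]; last by rewrite mul0r.
by rewrite il addrK eqxx in li.
Qed.

Lemma conj_row_shift i j : z 0 j * conj_row i 0 j = g 0 (i + 1) * conj_row (i + 1) 0 j.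
Proof.
have e : (g 0 (i + 1))^*%R * (u i j)^*%R = (u (i + 1) j)^*%R * (z 0 j)^*%R.
  by rewrite -!rmorphM u_shift.
rewrite !mxE -[LHS]mul1r -[X in X * _ = _](g_mod (i + 1)).
transitivity (g 0 (i + 1) * sqrtC 3 * z 0 j * ((g 0 (i + 1))^*%R * (u i j)^*%R)).
  by ring.
rewrite e; transitivity (g 0 (i + 1) * sqrtC 3 * (u (i + 1) j)^*%R *
  (z 0 j * (z 0 j)^*%R)); first by ring.
by rewrite z_mod; ring.
Qed.

(** D_u turns S (x) Z into T_u (x) 1: moving S across the block diagonal D_u shifts its blocks by
    one place, and by [conj_row_shift] a shifted block times Z is [g 0 i] times the block at that
    place. *)
Lemma phase_shift_D k :
  (cshift C *t (diag_mx z *t (1%:M : 'M[C]_(dim3 k)))) *m D_tens u k =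
  D_tens u k *m (phase_shift g *t (1%:M : 'M[C]_(dim3 k.+1))).
Proof.
set y := diag_mx z *t _.
have -> : cshift C *t y = (1%:M *t y) *m (cshift C *t 1%:M).
  by rewrite tensmx_mul mul1mx mulmx1.
have -> : phase_shift g *t (1%:M : 'M[C]_(dim3 k.+1)) =
    (diag_mx g *t 1%:M) *m (cshift C *t 1%:M) by rewrite tensmx_mul mulmx1.
rewrite D_tensE -[LHS]mulmxA cshift_dsum !mulmxA; congr (_ *m _).
rewrite -dsum_const tens_diag !dsumM; congr dsum; apply/funext => i.
rewrite tensmx_mul mulmx1 -scalemxAr mulmx1 mulmx_diag.
rewrite !tens_diag /dsum scaler_sumr; apply: eq_bigr => j _.
have := conj_row_shift (i - 1) j; rewrite subrK => e.
by rewrite mxE e -scalerA tensmxZr.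
Qed.

Lemma u_even_unitary k : u_even u k *m (u_even u k)^t* = 1%:M.
Proof.
have tens1 n : (u *t (1%:M : 'M[C]_n)) *m (u *t (1%:M : 'M[C]_n))^t* = 1%:M.
  by rewrite adjmx_tens tensmx_mul adjmx1 mulmx1 u_unitary tens11.
elim: k => [|k IHk]; first exact: tens1.
rewrite [u_even u k.+1]/= /u_next !adjmxM !mulmxA.
rewrite -(mulmxA _ (u *t _)) tens1 mulmx1 -(mulmxA _ (D_tens u k)) D_tens_unitary.
by rewrite mulmx1 adjmx_tens tensmx_mul IHk adjmx1 mulmx1 tens11.
Qed.

(** In the induction step W_(k+1) crosses the three factors of u_(2k+2): past 1 (x) u_(2k) it
    becomes S (x) Z (x) 1, past D_u it becomes T_u (x) 1, past u (x) 1 it becomes Z (x) 1. *)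
Lemma u_even_shift k :
  shift_tower (cshift C) (phase_shift g) k *m u_even u k =
  u_even u k *m (diag_mx z *t (1%:M : 'M[C]_(dim3 k))).
Proof.
elim: k => [|k IHk]; first by rewrite /= !tensmx_mul !mulmx1 phase_shift_u.
rewrite [u_even u k.+1]/= /u_next [shift_tower _ _ _]/= !mulmxA tensmx_mul mulmx1 IHk.
have -> : cshift C *t (u_even u k *m (diag_mx z *t (1%:M : 'M[C]_(dim3 k)))) =
    (1%:M *t u_even u k) *m (cshift C *t (diag_mx z *t (1%:M : 'M[C]_(dim3 k)))).
  by rewrite tensmx_mul mul1mx.
rewrite -(mulmxA (1%:M *t _)) phase_shift_D !mulmxA -!(mulmxA (_ *m D_tens u k)).
by rewrite !tensmx_mul phase_shift_u !mulmx1.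
Qed.

Lemma Delta_tensP k (x : 'M[C]_(dim3 k.+1)) :
  @Delta_tens C k x <->
  (diag_mx z *t (1%:M : 'M[C]_(dim3 k))) *m x = x *m (diag_mx z *t 1%:M).
Proof.
split=> [[y ->]|/(dsum_commute z_inj)//].
rewrite -/(dsum y) tens_diag !dsumM; congr dsum; apply/funext => i.
by rewrite -scalemxAl -scalemxAr mul1mx mulmx1.
Qed.

Lemma phase_shift_tower_unitary k : let W := shift_tower (cshift C) (phase_shift g) k in
  W *m W^t* = 1%:M.
Proof. by apply: shift_tower_unitary; [exact: cshift_unitary|exact: phase_shift_unitary]. Qed.

Lemma B_evenE k :
  B_even u k = [set x | Ad (shift_tower (cshift C) (phase_shift g) k) x = x].
Proof.
apply: (Ad_image_fixed (u_even_unitary k) (phase_shift_tower_unitary k) (u_even_shift k)).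
exact: Delta_tensP.
Qed.

Lemma Ad_Delta3E : Ad u @` Delta3 C = [set x | Ad (phase_shift g) x = x].
Proof.
apply: (Ad_image_fixed u_unitary phase_shift_unitary phase_shift_u) => x.
exact: Delta3P.
Qed.

(** u_(2k+2) differs from u_(2k+1) by the factor u (x) 1, which commutes with 1 (x) x. *)
Lemma B_odd_sub k : B_odd u k `<=` B_even u k.+1.
Proof.
move=> _ [_ [x ->] <-]; exists (1%:M *t x).
  by exists (fun=> x); rewrite -/(dsum _) dsum_const.
rewrite [u_even _ _]/= -Ad_Ad Ad_tens Ad_one /Ad mulmx1 u_unitary.
by [].
Qed.

End HadamardTower.

(** * The matrices diag(gam) F_3 and their intertwining relation *)

Lemma primitive_root3 (F : fieldType) (x : F) :
  x ^+ 3 = 1 -> x != 1 -> 3.-primitive_root x.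
Proof.
move=> x3 x1; have [m xm] := prim_order_exists (isT : (0 < 3)%N) x3.
rewrite dvdn_divisors // inE => /orP[/eqP m1|]; last first.
  by rewrite inE => /eqP m3; rewrite m3 in xm.
by move: x1; rewrite -(prim_expr_order xm) m1 expr1 eqxx.
Qed.

Section PhaseMatrix.
Variables (C : numClosedFieldType) (o : C).
Hypothesis o_mod : o * o^*%R = 1.
Hypothesis o_sum : 1 + o + o ^+ 2 = 0.

Lemma root3_cube : o ^+ 3 = 1.
Proof.
apply/eqP; rewrite -subr_eq0; apply/eqP.
transitivity ((o - 1) * (1 + o + o ^+ 2)); first by ring.
by rewrite o_sum mulr0.
Qed.

Lemma root3_conj : o^*%R = o ^+ 2.
Proof. by rewrite -[LHS]mul1r -root3_cube exprSr -mulrA o_mod mulr1. Qed.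

Lemma root3_neq1 : o != 1.
Proof.
apply/eqP => o1; move: o_sum; rewrite o1 expr1n -[X in X + X + X]/(1%:R) -!natrD.
by apply/eqP; rewrite pnatr_eq0.
Qed.

Definition phase_matrix (gam : 'rV[C]_3) : 'M[C]_3 :=
  \matrix_(i, j) (gam 0 i * (sqrtC 3)^-1 * o ^+ (i * j)).

Definition phase_steps (gam : 'rV[C]_3) : 'rV[C]_3 :=
  \row_i (gam 0 i * (gam 0 (i - 1))^*%R).

(** The diagonal of Z: going from row i+1 of F_3 to row i multiplies the entry of column j by this
    factor. *)
Definition root3_powers : 'rV[C]_3 := \row_j o^*%R ^+ j.

Lemma root3_prim : 3.-primitive_root o.
Proof. exact: primitive_root3 root3_cube root3_neq1. Qed.

Lemma root3_powers_inj i j : root3_powers 0 i = root3_powers 0 j -> i = j.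
Proof.
have co : 3.-primitive_root o^*%R by rewrite fmorph_primitive_root root3_prim.
move=> /eqP; rewrite !mxE (eq_prim_root_expr co) !modn_small // => /eqP.
exact: val_inj.
Qed.

Lemma root3_powers_mod j : root3_powers 0 j * (root3_powers 0 j)^*%R = 1.
Proof. by rewrite mxE rmorphXn /= conjCK -exprMn [_ * o]mulrC o_mod expr1n. Qed.

Section Unimodular.
Variable gam : 'rV[C]_3.
Hypothesis gam_mod : forall i, gam 0 i * (gam 0 i)^*%R = 1.

Lemma phase_steps_mod i : phase_steps gam 0 i * (phase_steps gam 0 i)^*%R = 1.
Proof.
by rewrite mxE rmorphM /= conjCK mulrACA gam_mod mul1r mulrC gam_mod.
Qed.

Lemma conj_invsqrt3 : ((sqrtC (3 : C))^-1)^*%R = (sqrtC 3)^-1.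
Proof. by apply: geC0_conj; rewrite invr_ge0 sqrtC_ge0 ler0n. Qed.

Lemma phase_matrix_mod i j :
  3 * (phase_matrix gam i j * (phase_matrix gam i j)^*%R) = 1.
Proof.
rewrite mxE !rmorphM /= conj_invsqrt3 rmorphXn /= mulrACA -exprMn o_mod expr1n.
by rewrite mulr1 mulrACA gam_mod mul1r -invfM -expr2 sqrtCK divff ?pnatr_eq0.
Qed.

Lemma phase_matrix_step i j :
  phase_steps gam 0 (i + 1) * phase_matrix gam i j =
  phase_matrix gam (i + 1) j * root3_powers 0 j.
Proof.
rewrite !mxE addrK.
(* The index [i + 1] is reduced modulo 3, which [o ^+ 3 = 1] absorbs. *)
have e : o ^+ ((i + 1)%R * j) * o^*%R ^+ j = o ^+ (i * j).
  rewrite exprM -exprMn (expr_mod _ root3_cube) addn1 exprSr -mulrA o_mod mulr1.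
  by rewrite exprM.
rewrite -[RHS]mulrA e.
transitivity (gam 0 (i + 1) * (sqrtC 3)^-1 * o ^+ (i * j) *
  (gam 0 i * (gam 0 i)^*%R)); first by ring.
by rewrite gam_mod mulr1.
Qed.

Lemma phase_matrix_unitary : phase_matrix gam *m (phase_matrix gam)^t* = 1%:M.
Proof.
(* Since the conjugate of [o] is [o ^+ 2], the product of rows i and j is a geometric sum in [q]. As
   i + 2j is i - j modulo 3, [q] is 1 exactly on the diagonal. *)
apply/matrixP => i j; rewrite !mxE; set q := o ^+ (i + 2 * j).
transitivity (gam 0 i * (gam 0 j)^*%R * 3^-1 * (1 + q + q ^+ 2)).
  have -> : 1 + q + q ^+ 2 = \sum_(k < 3) q ^+ k.
    by rewrite !big_ord_recl big_ord0 /= addr0 addrA.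
  rewrite mulr_sumr; apply: eq_bigr => k _.
  rewrite !mxE !rmorphM /= conj_invsqrt3 rmorphXn /= root3_conj.
  have -> : q ^+ k = o ^+ (i * k) * (o ^+ 2) ^+ (j * k).
    by rewrite -!exprM -exprD mulnDl mulnA.
  have <- : (sqrtC 3)^-1 * (sqrtC 3)^-1 = 3^-1 :> C by rewrite -invfM -expr2 sqrtCK.
  by ring.
case: (eqVneq i j) => [ij|ij].
  have -> : q = 1.
    by rewrite /q ij -mulSn exprM root3_cube expr1n.
  by rewrite ij gam_mod mul1r expr1n /=; field.
have q1 : q != 1.
  rewrite -(prim_order_dvd root3_prim).
  by move: ij; case: i @q => -[|[|[|//]]] ? /=; case: j => -[|[|[|//]]].
suff -> : 1 + q + q ^+ 2 = 0 by rewrite mulr0.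
have q3 : q ^+ 3 = 1 by rewrite -exprM mulnC exprM root3_cube expr1n.
apply: (mulfI (_ : q - 1 != 0)); first by rewrite subr_eq0.
by rewrite mulr0; transitivity (q ^+ 3 - 1); [ring|rewrite q3 subrr].
Qed.

End Unimodular.
End PhaseMatrix.

(** * Shifts commuting up to a scalar, and averages of diagonal multiples of a shift *)

Section Ratios.
Variable C : numClosedFieldType.

(** The scalar [c] enters [Ad] together with its conjugate and cancels. *)
Lemma Ad_commute n (c : C) (a b x : 'M[C]_n) : c * c^*%R = 1 ->
  a *m b = c *: (b *m a) -> Ad a (Ad b x) = Ad b (Ad a x).
Proof.
move=> cc ab; rewrite !Ad_Ad ab /Ad.
have -> : (c *: (b *m a))^t* = c^*%R *: (b *m a)^t*.
  by apply/matrixP => i j; rewrite !mxE rmorphM.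
by rewrite -!scalemxAl -scalemxAr scalerA cc scale1r.
Qed.

Lemma shift_tower_commute (c : C) (s t t' : 'M[C]_3) : t *m t' = c *: (t' *m t) ->
  forall k, shift_tower s t k *m shift_tower s t' k =
    c *: (shift_tower s t' k *m shift_tower s t k).
Proof.
move=> tt; elim=> [|k IHk].
  have [tensZ _] := GRing.semilinear_linear
    (tensmx_linearl (m := 3) (1%:M : 'M[C]_(dim3 0))).
  by rewrite /= !tensmx_mul tt mulmx1 tensZ.
by rewrite [shift_tower s t _]/= [shift_tower s t' _]/= !tensmx_mul IHk tensmxZr.
Qed.

Definition mean3 (d : 'rV[C]_3) : C := 3^-1 * \sum_i d 0 i.

Lemma phase_shiftE (g : 'rV[C]_3) i j : phase_shift g i j = g 0 i *+ (i == j + 1).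
Proof. by rewrite /phase_shift mul_diag_mx !mxE mulr_natr. Qed.

Lemma phase_shift_diag (g d : 'rV[C]_3) :
  phase_shift g *m diag_mx d = diag_mx (\row_i d 0 (i - 1)) *m phase_shift g.
Proof.
apply/matrixP => i j; rewrite mul_diag_mx mul_mx_diag mxE [RHS]mxE.
rewrite [X in _ = X * _]mxE !phase_shiftE.
case: (eqVneq i (j + 1)) => [->|]; last by rewrite !mulr0n mul0r mulr0.
by rewrite addrK mulrC.
Qed.

Lemma phase_shift_mulE (g : 'rV[C]_3) (x : 'M[C]_3) i j :
  (phase_shift g *m x) i j = g 0 i * x (i - 1) j.
Proof.
rewrite mxE (bigD1 (i - 1)) //= big1 => [|k ki].
  by rewrite phase_shiftE subrK eqxx addr0.
rewrite phase_shiftE; case: eqP => [ik|_]; last by rewrite mulr0n mul0r.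
by rewrite ik addrK eqxx in ki.
Qed.

Lemma sub1_3 (i : 'I_3) : i - 1 - 1 - 1 = i.
Proof. by apply/val_inj; case: i => -[|[|[|//]]]. Qed.

Lemma phase_shift3 (g : 'rV[C]_3) :
  (forall i, g 0 i * (g 0 (i - 1) * g 0 (i - 1 - 1)) = 1) ->
  phase_shift g *m phase_shift g *m phase_shift g = 1%:M.
Proof.
move=> g1; apply/matrixP => i j.
rewrite -mulmxA -[X in _ *m (_ *m X)]mulmx1 !phase_shift_mulE.
by rewrite !mulrA -(mulrA _ _ (g 0 _)) g1 mul1r sub1_3.
Qed.

Lemma phase_steps3 (gam : 'rV[C]_3) : (forall i, gam 0 i * (gam 0 i)^*%R = 1) ->
  phase_shift (phase_steps gam) *m phase_shift (phase_steps gam) *m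
  phase_shift (phase_steps gam) = 1%:M.
Proof.
move=> gam_mod; apply: phase_shift3 => i; rewrite !mxE sub1_3.
transitivity ((gam 0 i * (gam 0 i)^*%R) * (gam 0 (i - 1) * (gam 0 (i - 1))^*%R) *
   (gam 0 (i - 1 - 1) * (gam 0 (i - 1 - 1))^*%R)); first by ring.
by rewrite !gam_mod !mulr1.
Qed.

Lemma cshift3 : cshift C *m cshift C *m cshift C = 1%:M.
Proof.
have -> : cshift C = phase_shift (const_mx 1).
  by apply/matrixP => i j; rewrite phase_shiftE !mxE.
by apply: phase_shift3 => i; rewrite !mxE !mulr1.
Qed.

Section OneShift.
Variable g : 'rV[C]_3.
Hypothesis g_mod : forall i, g 0 i * (g 0 i)^*%R = 1.

Lemma Ad_phase_shift_diag (d : 'rV[C]_3) :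
  Ad (phase_shift g) (diag_mx d *m phase_shift g) =
  diag_mx (\row_i d 0 (i - 1)) *m phase_shift g.
Proof.
rewrite /Ad mulmxA phase_shift_diag -mulmxA phase_shift_unitary //.
by rewrite mulmx1.
Qed.

(** [Ad (phase_shift g)] fixes [phase_shift g] and permutes the entries of the diagonal factor
    cyclically, so averaging replaces each entry by their mean. *)
Lemma avg3_phase_shift_diag (d : 'rV[C]_3) :
  avg3 (Ad (phase_shift g)) (diag_mx d *m phase_shift g) = mean3 d *: phase_shift g.
Proof.
rewrite /avg3 !Ad_phase_shift_diag -!mulmxDl scalemxAl.
rewrite -[RHS]mul_scalar_mx; congr (_ *m _).
apply/matrixP => i j; rewrite !mxE; case: eqP => [->|_]; last first.
  by rewrite !mulr0n !addr0 mulr0.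
rewrite !mulr1n /mean3; congr (_ * _).
rewrite !big_ord_recl big_ord0 addr0.
have dE (p q : 'I_3) : p = q :> nat -> d 0 p = d 0 q by move=> /val_inj ->.
(* The indices are j, j-1, j-2 modulo 3; for each j the terms are rearranged into the order 0, 1,
   2. *)
by case: j => -[|[|[|//]]] lj;
  [rewrite -addrA [X in _ + X]addrC|rewrite [X in X + _]addrC -addrA
  |rewrite [LHS]addrC [X in _ + X]addrC];
  congr (_ + (_ + _)); apply: dE.
Qed.

End OneShift.
End Ratios.

(** * Comparison of two phase vectors *)

Section TwoPhases.
Variable C : numClosedFieldType.
Local Notation unimodular gam := (forall i : 'I_3, gam 0 i * (gam 0 i)^*%R = 1).

Definition phase_ratio (gam del : 'rV[C]_3) : 'rV[C]_3 :=
  \row_i (del 0 i * (gam 0 i)^*%R).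

Lemma phase_ratio_mod (gam del : 'rV[C]_3) :
  unimodular gam -> unimodular del -> unimodular (phase_ratio gam del).
Proof.
move=> gam_mod del_mod i; rewrite !mxE rmorphM /= conjCK mulrACA del_mod mul1r.
by rewrite mulrC.
Qed.

Lemma phase_shift_ratio (gam del : 'rV[C]_3) : unimodular gam ->
  phase_shift (phase_steps del) =
  diag_mx (phase_steps (phase_ratio gam del)) *m phase_shift (phase_steps gam).
Proof.
move=> gam_mod; rewrite /phase_shift mulmxA mulmx_diag; congr (diag_mx _ *m _).
apply/rowP => i; rewrite !mxE rmorphM /= conjCK.
transitivity (del 0 i * (del 0 (i - 1))^*%R * ((gam 0 i * (gam 0 i)^*%R) *
  (gam 0 (i - 1) * (gam 0 (i - 1))^*%R))); first by rewrite !gam_mod !mulr1.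
by ring.
Qed.

(* Each average maps the other shift to a multiple of its own one, so that the
   commutation relation at [t] reads [mean3 r *: s = (mean3 r * m) *: t]. *)
Lemma avg3_commute_ratio (gam del : 'rV[C]_3) :
  let r := phase_steps (phase_ratio gam del) in
  let s := phase_shift (phase_steps gam) in
  let t := phase_shift (phase_steps del) in
  unimodular gam -> unimodular del ->
  avg3 (Ad s) (avg3 (Ad t) t) = avg3 (Ad t) (avg3 (Ad s) t) ->
  mean3 r = 0 \/ forall i j, r 0 i = r 0 j.
Proof.
move=> r s t gam_mod del_mod.
have tE : t = diag_mx r *m s := phase_shift_ratio del gam_mod.
have s_avg : avg3 (Ad s) t = mean3 r *: s.
  by rewrite tE avg3_phase_shift_diag //; exact: phase_steps_mod.
have t_fix : Ad t t = t.
  have tt : t *m t^t* = 1%:M by apply/phase_shift_unitary/phase_steps_mod.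
  exact/(Ad_fixedP tt).
have t_avg : exists m, avg3 (Ad t) s = m *: t.
  exists (mean3 (phase_steps (phase_ratio del gam))).
  rewrite /s (phase_shift_ratio gam del_mod) avg3_phase_shift_diag //.
  exact: phase_steps_mod.
case: t_avg => m t_avg.
have [tZ _] := GRing.semilinear_linear (avg3_linear (@Ad_linear C 3 t)).
rewrite (avg3_fixed t_fix) s_avg tZ /= t_avg scalerA tE => eq_s.
have [->|r0] := eqVneq (mean3 r) 0; [by left|right].
move: (mean3 r) r0 eq_s => M r0 eq_s.
(* Compare the entries at (i, i-1), where [s] is nonzero, and cancel [M]: every [r 0 i] is the
   inverse of [m]. *)
have mr i : m * r 0 i = 1.
  have := congr1 (fun x : 'M[C]_3 => x i (i - 1)) eq_s.
  rewrite mxE [RHS]mxE mul_diag_mx [X in _ = _ * X]mxE /s phase_shiftE subrK eqxx mulr1n.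
  rewrite -[RHS]mulrA => /(mulfI r0) e.
  have g0 : phase_steps gam 0 i != 0.
    apply/eqP => g0; have := phase_steps_mod gam_mod i.
    by rewrite g0 mul0r => /eqP; rewrite eq_sym oner_eq0.
  by apply: (mulIf g0); rewrite mul1r -mulrA -e.
move=> i j; have m0 : m != 0.
  by apply/eqP => m0; have := mr i; rewrite m0 mul0r => /eqP; rewrite eq_sym oner_eq0.
by apply: (mulfI m0); rewrite !mr.
Qed.

(** A constant [r] makes the ratios of the phases a geometric progression whose quotient is a power
    o^p. Multiplying row i of F_3 by o^(p i) only moves its columns by p. *)
Lemma constant_ratio_equiv (o : C) (gam del : 'rV[C]_3) :
  let r := phase_steps (phase_ratio gam del) in
  1 + o + o ^+ 2 = 0 -> unimodular gam -> unimodular del ->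
  (forall i j, r 0 i = r 0 j) ->
  hadamard_equiv (phase_matrix o gam) (phase_matrix o del).
Proof.
move=> r o_sum gam_mod del_mod r_const.
set e := phase_ratio gam del; have e_mod := phase_ratio_mod gam_mod del_mod.
have eS i : e 0 i = r 0 0 * e 0 (i - 1).
  rewrite (r_const 0 i) [r _ _]mxE -mulrA [_^* * _]mulrC.
  by rewrite e_mod mulr1.
have delE i : del 0 i = e 0 i * gam 0 i.
  by rewrite mxE -mulrA [_^* * _]mulrC gam_mod mulr1.
(* Three steps of the progression lead around the cycle back to the start. *)
have r3 : r 0 0 ^+ 3 = 1.
  have e0 : e 0 0 != 0.
    apply/eqP => e0; have := e_mod 0.
    by rewrite e0 mul0r => /eqP; rewrite eq_sym oner_eq0.
  apply: (mulIf e0); rewrite mul1r [in RHS]eS [in RHS]eS [in RHS]eS sub1_3.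
  by rewrite !exprS expr0 mulr1 !mulrA.
have [p rp] := prim_rootP (root3_prim o_sum) r3.
have eE i : e 0 i = r 0 0 ^+ i * e 0 0.
  have eE1 (l l' : 'I_3) : l = l'.+1 :> nat -> e 0 l = r 0 0 * e 0 l'.
    move=> ll; rewrite eS; congr (_ * e 0 _); apply/val_inj.
    by move: ll; case: l => -[|[|[|//]]] ?; case: l' => -[|[|[|//]]] ? //=.
  case: i => -[|[|[|//]]] li.
  - by rewrite expr0 mul1r; congr (e 0 _); exact: val_inj.
  - by rewrite (eE1 _ 0).
  - by rewrite (eE1 _ 1) // (eE1 1 0) // expr2 mulrA.
(* The columns move by j -> j + p; the inverse appears because [col_perm] is multiplication by the
   inverse permutation matrix. The remaining factor is the common phase [e 0 0]. *)
exists (perm (addIr p))^-1%g, (const_mx (e 0 0)); split=> [i|].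
  by rewrite mxE; apply/eqP; rewrite -(@eqrXn2 _ 2) // normCK e_mod expr1n.
rewrite -col_permE; apply/matrixP => i j; rewrite mul_mx_diag !mxE permE.
rewrite /= delE eE rp (exprM _ i (j + p)%R).
have -> : o ^+ i ^+ (j + p)%R = o ^+ i ^+ j * o ^+ i ^+ p.
  have oi3 : (o ^+ i) ^+ 3 = 1 by rewrite exprAC (root3_cube o_sum) expr1n.
  by rewrite /= (expr_mod _ oi3) exprD.
rewrite exprM (exprAC _ p i) [e 0 0]mxE.
by ring.
Qed.

End TwoPhases.

(** * Two shifts commuting up to a scalar other than 1 *)

Section CommutingShifts.
Variables (C : numClosedFieldType) (c : C) (g r : 'rV[C]_3).
Local Notation s := (phase_shift g).
Local Notation t := (diag_mx r *m s).
Hypothesis r_shift : forall i, r 0 (i - 1) = c * r 0 i.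

Lemma phase_shift_commute : s *m t = c *: (t *m s).
Proof.
rewrite mulmxA phase_shift_diag !scalemxAl.
congr (_ *m _ *m _).
by apply/matrixP => i j; rewrite !mxE r_shift mulrnAr.
Qed.

Hypothesis c1 : c != 1.
Hypothesis r_mod : forall i, r 0 i * (r 0 i)^*%R = 1.
Hypothesis g_mod : forall i, g 0 i * (g 0 i)^*%R = 1.

Lemma unimodular_neq0 (d : 'rV[C]_3) : (forall i, d 0 i * (d 0 i)^*%R = 1) ->
  forall i, d 0 i != 0.
Proof.
move=> d_mod i; apply/eqP => d0; have := d_mod i.
by rewrite d0 mul0r => /eqP; rewrite eq_sym oner_eq0.
Qed.

(** Neighbouring entries differ by the factor [c], which is not 1, and any two distinct indices
    modulo 3 are neighbours. *)
Lemma shifted_phases_inj i j : r 0 i = r 0 j -> i = j.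
Proof.
have r0 := unimodular_neq0 r_mod.
have step k : r 0 (k - 1) != r 0 k.
  by apply: contraNneq c1 => rk; apply/eqP/(mulIf (r0 k)); rewrite -r_shift rk mul1r.
move=> rij; apply/eqP; apply: contraT => ij.
have [e|e] : i = j - 1 \/ j = i - 1.
  move: ij; case: i {rij} => -[|[|[|//]]] li; case: j => -[|[|[|//]]] lj //= _;
  by [left; apply/val_inj|right; apply/val_inj].
- by have := step j; rewrite -e rij eqxx.
- by have := step i; rewrite -e rij eqxx.
Qed.

(** Commuting with [s] and with [diag_mx r *m s] means commuting with [diag_mx r] too. Its entries
    are distinct, so [x] is diagonal, and commuting with [s] makes the diagonal constant. *)
Lemma fixed_both_scalars :
  [set x | Ad s x = x] `&` [set x | Ad t x = x] = scalars3 C.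
Proof.
have ss : s *m s^t* = 1%:M by exact: phase_shift_unitary.
have tt : t *m t^t* = 1%:M.
  rewrite adjmxM mulmxA -(mulmxA _ s) ss mulmx1.
  exact: diag_unitary.
apply/seteqP; split=> [x [/= /(Ad_fixedP ss) sx /(Ad_fixedP tt) tx]|x [a ->]].
  have rx : diag_mx r *m x = x *m diag_mx r.
    have e : diag_mx r *m x *m s = x *m diag_mx r *m s.
      by rewrite -mulmxA -sx mulmxA tx mulmxA.
    rewrite -[LHS]mulmx1 -[RHS]mulmx1 -ss.
    by rewrite (mulmxA _ s) e -(mulmxA _ s).
  have /(Delta3P _ shifted_phases_inj) /is_diag_mxP xd := rx.
  have xS i : x i i = x (i - 1) (i - 1).
    have := congr1 (fun m : 'M[C]_3 => m i (i - 1)) sx.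
    rewrite phase_shift_mulE [RHS]mxE (bigD1 i) //= big1 => [|k ki].
      rewrite addr0 phase_shiftE subrK eqxx mulr1n mulrC.
      by move=> /(mulIf (unimodular_neq0 g_mod i)).
    by rewrite xd ?mul0r // eq_sym.
  have x01 : x 1 1 = x 0 0.
    by rewrite xS; congr (x _ _); apply/val_inj.
  have x02 : x (-1) (-1) = x 0 0 by rewrite (xS 0) sub0r.
  exists (x 0 0); apply/matrixP => i j; rewrite !mxE.
  case: (eqVneq i j) => [<-|ij]; last by rewrite xd.
  rewrite mulr1n; case: i => -[|[|[|//]]] li.
  - by congr (x _ _); exact: val_inj.
  - by rewrite -x01; congr (x _ _); exact: val_inj.
  - by rewrite -x02; congr (x _ _); exact: val_inj.
by split; [apply/(Ad_fixedP ss)|apply/(Ad_fixedP tt)]; rewrite scalar_mxC.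
Qed.

End CommutingShifts.

(** * Algebra of condition (iii) *)

Section CubeRoots.
Variable F : fieldType.

(** The two equations say that [r] has mean 0, together with the complex conjugate statement;
    inverses stand for conjugates. Clearing denominators turns them into quadratic relations for
    [p = x * y], with constant terms [x ^+ 3] and [y ^+ 3]. *)
Lemma cube_roots_sum (x y : F) : x != 0 -> y != 0 -> 3 != 0 :> F ->
  y + x^-1 + y^-1 * x = 0 -> y^-1 + x + y * x^-1 = 0 ->
  [/\ x ^+ 3 = 1, y ^+ 3 = 1 & x * y != 1].
Proof.
move=> x0 y0 n3 e1 e2; pose p := x * y; pose X := x ^+ 3.
have E1 : p ^+ 2 + p + X = 0.
  transitivity (x ^+ 2 * y * (y + x^-1 + y^-1 * x));
    [by rewrite /p /X; field; rewrite x0 y0|by rewrite e1 mulr0].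
have E2 : p + p ^+ 2 + y ^+ 3 = 0.
  transitivity (x * y ^+ 2 * (y^-1 + x + y * x^-1));
    [by rewrite /p; field; rewrite x0 y0|by rewrite e2 mulr0].
have yX : y ^+ 3 = X by apply: (addrI (p + p ^+ 2)); rewrite E2 [p + _]addrC.
have p3 : p ^+ 3 = X ^+ 2 by rewrite /p exprMn yX.
have p0 : p != 0 by rewrite mulf_neq0.
have Xp : X + p != 0.
  apply/eqP => Xp; have := expf_neq0 2 p0.
  have -> : p ^+ 2 = p ^+ 2 + p + X - (X + p) by ring.
  by rewrite E1 Xp subrr eqxx.
(* From [p ^+ 3 = X ^+ 2] and the quadratic relation, (X - 1)(X + p) = 0. *)
have X1 : X = 1.
  apply/eqP; rewrite -subr_eq0; apply/eqP/(mulIf Xp); rewrite mul0r.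
  transitivity (X ^+ 2 - p ^+ 3 + (p - 1) * (p ^+ 2 + p + X)); first by ring.
  by rewrite p3 E1 subrr mulr0 addr0.
split; rewrite ?yX //; apply/eqP => p1; move: E1 n3.
rewrite X1 /p p1 expr1n => e /eqP; apply.
by rewrite -e; ring.
Qed.

(** Of the nine pairs (w^i, w^j), the three with i + j divisible by 3 have product 1; the list
    consists of the other six. *)
Lemma primitive_root3_pairs (w x y : F) : 3.-primitive_root w ->
  ((x, y) \in [:: (w, w); (w ^+ 2, w ^+ 2); (1, w); (1, w ^+ 2); (w, 1); (w ^+ 2, 1)])
  <-> [/\ x ^+ 3 = 1, y ^+ 3 = 1 & x * y != 1].
Proof.
move=> w_prim; have w3 := prim_expr_order w_prim.
have wE i : (w ^+ i == 1) = (3 %| i)%N by rewrite -(prim_order_dvd w_prim).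
have w1 : w != 1 by rewrite -[w]expr1 wE.
have w2 : w ^+ 2 != 1 by rewrite wE.
have w23 : (w ^+ 2) ^+ 3 = 1 by rewrite -exprM mulnC exprM w3 expr1n.
have w21 : w ^+ 2 * w ^+ 2 != 1 by rewrite -exprD wE.
split=> [|[x3 y3 xy]].
  rewrite !inE !xpair_eqE => /or4P[|||/or3P[||]] /andP[/eqP-> /eqP->]; split;
  by rewrite ?expr1n ?mul1r ?mulr1 -?expr2.
have [[i li] /= xE] := prim_rootP w_prim x3.
have [[j lj] /= yE] := prim_rootP w_prim y3.
move: xy; rewrite xE yE -exprD wE.
case: i li {xE} => [|[|[|//]]] _; case: j lj {yE} => [|[|[|//]]] _ //= _;
by rewrite ?expr0 ?expr1 !inE !xpair_eqE !eqxx ?orbT.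
Qed.

End CubeRoots.

(** * Averages on M_3 and nondegeneracy of the trace form *)

Section MatrixAverages.
Variable C : numClosedFieldType.

Lemma trace_form_inj n (x y : 'M[C]_n) :
  (forall a : 'M[C]_n, \tr (a *m x) = \tr (a *m y)) -> x = y.
Proof.
move=> axy; apply/matrixP => i j.
have trE (z : 'M[C]_n) : \tr (delta_mx j i *m z) = z i j.
  rewrite /mxtrace (bigD1 j) //= big1 => [|k kj].
    rewrite addr0 mxE (bigD1 i) //= big1 => [|l li]; first by rewrite mxE !eqxx mul1r addr0.
    by rewrite mxE (negPf li) andbF mul0r.
  by rewrite mxE big1 // => l _; rewrite mxE (negPf kj) mul0r.
by rewrite -!trE axy.
Qed.

Lemma ntrace_linear n : scalar (@ntrace C n).
Proof. by move=> a x y; rewrite /ntrace linearP /= mulrDl mulrA. Qed.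

Lemma ntrace_form_inj n (x y : 'M[C]_n) : (0 < n)%N ->
  (forall a : 'M[C]_n, ntrace (a *m x) = ntrace (a *m y)) -> x = y.
Proof.
move=> n0 axy; apply: trace_form_inj => a; have := axy a.
by apply: mulIf; rewrite invr_eq0 pnatr_eq0 -lt0n.
Qed.

Lemma Ad_psd n (w x : 'M[C]_n) : psdmx x -> psdmx (Ad w x).
Proof.
move=> x0 xi; have := x0 (w^t* *m xi).
by rewrite adjmxM trmxCK /Ad !mulmxA.
Qed.

Lemma Ad_cond_exp (w : 'M[C]_3) : w *m w^t* = 1%:M -> w *m w *m w = 1%:M ->
  trace_preserving_cond_exp (fun x y : 'M[C]_3 => x *m y) (@psdmx C 3)
    (@ntrace C 3) setT (setT `&` [set x | Ad w x = x]) (avg3 (Ad w)).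
Proof.
move=> ww w3; apply: avg3_cond_exp => //.
- exact: Ad_linear.
- exact: Ad_mul.
- exact: Ad3.
- exact: Ad_psd.
- by move=> x; rewrite /ntrace Ad_trace.
- by move=> x y x0 y0 xi; rewrite mulmxDr mulmxDl mxE addr_ge0 ?x0 ?y0.
- by move=> a x a0 x0 xi; rewrite -scalemxAr -scalemxAl mxE mulr_ge0 ?x0.
- by move=> z a x y; rewrite mulmxDl scalemxAl.
- by move=> z _ a x y; rewrite mulmxDr scalemxAr.
- exact: ntrace_linear.
Qed.

Lemma avg3_tens (s t : 'M[C]_3) x :
  avg3 (Ad (shift_tower s t 0)) (x *t (1%:M : 'M[C]_(dim3 0))) =
  avg3 (Ad t) x *t (1%:M : 'M[C]_(dim3 0)).
Proof.
rewrite /avg3 /= !Ad_tens !Ad_one.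
have [tensZ tensD] := GRing.semilinear_linear
  (tensmx_linearl (m := 3) (1%:M : 'M[C]_(dim3 0))).
by rewrite tensZ !tensD.
Qed.

Lemma tens1_inj n (x y : 'M[C]_n) :
  x *t (1%:M : 'M[C]_1) = y *t (1%:M : 'M[C]_1) -> x = y.
Proof.
move=> xy; apply/matrixP => i j.
have := congr1 (fun m : 'M[C]_(n * 1) => m (mxtens_index (i, 0)) (mxtens_index (j, 0))) xy.
by rewrite !tensmxE !mxE !mulr1.
Qed.

End MatrixAverages.

(** * Commuting implementing unitaries, and R_u as a fixed point algebra *)

Section OperatorSide.
Variables (R : realType) (H : gns R).
Local Notation rep := (@gns_rep R H _).

(** The scalar disappears in [Ad], so the matrix automorphisms commute at each level. [UV] and [VU]
    are then isometries that agree on the dense vectors. *)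
Lemma implements_commute (s t t' : 'M[R[i]]_3) (U V : H -> H) (c : R[i]) :
  s *m s^t* = 1%:M -> t *m t^t* = 1%:M -> t' *m t'^t* = 1%:M ->
  s *m s *m s = 1%:M -> t *m t *m t = 1%:M -> t' *m t' *m t' = 1%:M ->
  c * c^*%R = 1 -> t *m t' = c *: (t' *m t) ->
  implements s t U -> implements s t' V ->
  forall xi, U (V xi) = V (U xi).
Proof.
move=> ss tt tt' s3 t3 t'3 cc ttc [_ UU _ Uvec Urep] [_ VV _ Vvec Vrep].
have W3 := shift_tower3 s3 t3; have W'3 := shift_tower3 s3 t'3.
have WC k x : Ad (shift_tower s t k) (Ad (shift_tower s t' k) x) =
    Ad (shift_tower s t' k) (Ad (shift_tower s t k) x).
  exact: Ad_commute cc (shift_tower_commute _ ttc k).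
move=> xi; apply: gns_inj => k x.
set A := Ad (shift_tower s t k); set B := Ad (shift_tower s t' k).
(* [A] and [B] commute and have order 3, so [y] is the preimage of [x] under both [A B] and
   [B A]. *)
pose y := B (B (A (A x))).
have UVy : U (V (rep y (gns_vec H))) = rep x (gns_vec H).
  by rewrite Vrep Vvec Urep Uvec /y (Ad3 (W'3 k)) (Ad3 (W3 k)).
have VUy : V (U (rep y (gns_vec H))) = rep x (gns_vec H).
  by rewrite Urep Uvec Vrep Vvec -WC (Ad3 (W'3 k)) (Ad3 (W3 k)).
by rewrite -{1}UVy UU VV -VUy VV UU.
Qed.

(** The even algebras are the fixed matrices of their level, and each odd algebra lies in the next
    even one. *)
Lemma hadamard_subfactorE (u : 'M[R[i]]_3) (z g : 'rV[R[i]]_3) :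
  u *m u^t* = 1%:M -> (forall i j, 3 * (u i j * (u i j)^*%R) = 1) ->
  (forall i j, z 0 i = z 0 j -> i = j) -> (forall j, z 0 j * (z 0 j)^*%R = 1) ->
  (forall i, g 0 i * (g 0 i)^*%R = 1) ->
  (forall i j, g 0 (i + 1) * u i j = u (i + 1) j * z 0 j) ->
  hadamard_subfactor H u = @fixed_factor R H (cshift R[i]) (phase_shift g).
Proof.
move=> u_un u_mod z_inj z_mod g_mod u_shift; congr strong_closure.
have BE k := B_evenE u_un u_mod z_inj z_mod g_mod u_shift k.
apply/seteqP; split=> [T [k _ [] [x xB <-]]|T [k _ [x xW <-]]].
- by exists k => //; exists x => //; rewrite -BE.
- exists k.+1 => //; exists x => //; rewrite -BE.
  exact: (B_odd_sub u_un xB).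
by exists k => //; left; exists x => //; rewrite BE.
Qed.

End OperatorSide.

(** * Points of the unit circle *)

Section Cis.
Variable R : realType.

Lemma cisD (a b : R) : cis (a + b) = cis a * cis b.
Proof. by rewrite /cis cosD sinD; simpc; rewrite [sin a * cos b + _]addrC. Qed.

Lemma cis_conj (a : R) : (cis a)^*%R = cis (- a).
Proof. by rewrite /cis cosN sinN. Qed.

Lemma cis0 : cis (0 : R) = 1.
Proof. by rewrite /cis cos0 sin0. Qed.

Lemma cis_mod (a : R) : cis a * (cis a)^*%R = 1.
Proof. by rewrite cis_conj -cisD subrr cis0. Qed.

Lemma cis_third_sum : let o := cis (- (2 * pi / 3) : R) in 1 + o + o ^+ 2 = 0.
Proof.
move=> o; have o1 : o != 1.
  rewrite /o /cis eq_complex /= sinN oppr_eq0; apply/negP => /andP[_ /eqP s0].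
  have : 0 < sin (2 * pi / 3 : R).
    by have := pi_gt0 R => p0; apply: sin_gt0_pi; apply/andP; split; lra.
  by rewrite s0 ltxx.
have o3 : o ^+ 3 = 1.
  have -> : o ^+ 3 = cis (- (pi *+ 2)).
    by rewrite !exprS expr0 mulr1 -!cisD; congr cis; rewrite -mulr_natl; field.
  by rewrite -cis_conj /cis cos2pi sin2pi rmorph1.
apply: (mulfI (_ : o - 1 != 0)); first by rewrite subr_eq0.
by rewrite mulr0; transitivity (o ^+ 3 - 1); [ring|rewrite o3 subrr].
Qed.

End Cis.

(** * Specialization to diag(1, e^(i t1), e^(i t2)) F_3 *)

Section PhaseFourier.
Variable R : realType.
Local Notation o := (cis (- (2 * pi / 3) : R)).

Definition phases (t1 t2 : R) : 'rV[R[i]]_3 := \row_(j < 3) [:: 1; cis t1; cis t2]`_j.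

Definition phase_unitary (t1 t2 : R) : 'M[R[i]]_3 := phase_shift (phase_steps (phases t1 t2)).

Lemma phases_mod (t1 t2 : R) i : phases t1 t2 0 i * (phases t1 t2 0 i)^*%R = 1.
Proof.
rewrite mxE; case: i => -[|[|[|//]]] ? /=; rewrite ?cis_mod //.
by rewrite rmorph1 mulr1.
Qed.

Lemma phaseF3E (t1 t2 : R) : phaseF3 t1 t2 = phase_matrix o (phases t1 t2).
Proof.
by apply/matrixP => i j; rewrite /phaseF3 mul_diag_mx !mxE mulrA.
Qed.

Lemma phase_unitary_adj (t1 t2 : R) : phase_unitary t1 t2 *m (phase_unitary t1 t2)^t* = 1%:M.
Proof. by apply/phase_shift_unitary/phase_steps_mod; exact: phases_mod. Qed.

Lemma phase_unitary3 (t1 t2 : R) :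
  phase_unitary t1 t2 *m phase_unitary t1 t2 *m phase_unitary t1 t2 = 1%:M.
Proof. by apply: phase_steps3; exact: phases_mod. Qed.

Lemma hadamard_phaseF3E (H : gns R) (t1 t2 : R) :
  hadamard_subfactor H (phaseF3 t1 t2) =
  @fixed_factor R H (cshift R[i]) (phase_unitary t1 t2).
Proof.
have o_sum := cis_third_sum R; have o_mod := cis_mod (- (2 * pi / 3) : R).
have g_mod := phases_mod t1 t2.
rewrite phaseF3E; apply: (@hadamard_subfactorE R H _ (root3_powers o)).
- exact: phase_matrix_unitary.
- exact: phase_matrix_mod.
- exact: root3_powers_inj.
- exact: root3_powers_mod.
- exact: phase_steps_mod.
- exact: phase_matrix_step.
Qed.

Lemma Ad_phaseF3E (t1 t2 : R) :
  Ad (phaseF3 t1 t2) @` Delta3 R[i] = [set x | Ad (phase_unitary t1 t2) x = x].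
Proof.
have o_sum := cis_third_sum R; have o_mod := cis_mod (- (2 * pi / 3) : R).
have g_mod := phases_mod t1 t2.
rewrite phaseF3E; apply: (@Ad_Delta3E _ _ (root3_powers o)).
- exact: phase_matrix_unitary.
- exact: root3_powers_inj.
- exact: phase_steps_mod.
- exact: phase_matrix_step.
Qed.

(* These are the entries of the diagonal [r] such that
   [phase_unitary b1 b2 = diag_mx r *m phase_unitary a1 a2]. *)
Lemma phase_ratio_steps (a1 a2 b1 b2 : R) :
  phase_steps (phase_ratio (phases a1 a2) (phases b1 b2)) =
  \row_(j < 3) [:: cis (a2 - b2); cis (b1 - a1); cis (a1 - b1 - (a2 - b2))]`_j.
Proof.
have rE (k : 'I_3) : phase_ratio (phases a1 a2) (phases b1 b2) 0 k =
    [:: 1; cis (b1 - a1); cis (b2 - a2)]`_k.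
  rewrite !mxE; case: k => -[|[|[|//]]] ? /=; rewrite ?cis_conj -?cisD //.
  by rewrite rmorph1 mulr1.
apply/rowP => -[[|[|[|//]]] lj]; rewrite [LHS]mxE !rE [RHS]mxE /=.
- by rewrite cis_conj opprB mul1r.
- by rewrite rmorph1 mulr1.
- by rewrite cis_conj -cisD; congr cis; ring.
Qed.

(** Of the two cases in [avg3_commute_ratio], a constant ratio would make the Hadamard matrices
    equivalent; mean 0 leads to the cube roots. *)
Lemma commuting_averages_cond (a1 a2 b1 b2 : R) (w : R[i]) :
  let s := phase_unitary a1 a2 in let t := phase_unitary b1 b2 in
  3.-primitive_root w -> ~ hadamard_equiv (phaseF3 a1 a2) (phaseF3 b1 b2) ->
  (forall x, avg3 (Ad s) (avg3 (Ad t) x) = avg3 (Ad t) (avg3 (Ad s) x)) ->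
  (cis (a1 - b1), cis (a2 - b2)) \in
    [:: (w, w); (w ^+ 2, w ^+ 2); (1, w); (1, w ^+ 2); (w, 1); (w ^+ 2, 1)].
Proof.
move=> s t w_prim not_equiv st.
have [r0|r_const] := avg3_commute_ratio (phases_mod a1 a2) (phases_mod b1 b2) (st t).
  apply/(primitive_root3_pairs _ _ w_prim).
  have c0 (a : R) : cis a != 0.
    by apply/eqP => c0; have := cis_mod a; rewrite c0 mul0r => /eqP; rewrite eq_sym oner_eq0.
  have cV (a : R) : (cis a)^-1 = cis (- a).
    by apply: (mulfI (c0 a)); rewrite divff ?c0 // -cis_conj cis_mod.
  have e : cis (a2 - b2) + cis (b1 - a1) + cis (a1 - b1 - (a2 - b2)) = 0.
    move: r0 => /eqP; rewrite mulf_eq0 invr_eq0 pnatr_eq0 /= phase_ratio_steps => /eqP.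
    by rewrite !big_ord_recl big_ord0 !mxE /= addr0 addrA.
  apply: (cube_roots_sum (c0 _) (c0 _)).
  - by rewrite pnatr_eq0.
  - rewrite !cV -cisD -[RHS]e opprB; congr (_ + cis _); ring.
  (* The second equation is the complex conjugate of the first. *)
  - have := congr1 (fun z : R[i] => z^*%R) e.
    rewrite /= !rmorphD /= !cis_conj rmorph0 !opprB => e'.
    by rewrite !cV -cisD -[RHS]e' opprB; congr (_ + _ + cis _); ring.
case: not_equiv; rewrite !phaseF3E; apply: constant_ratio_equiv => //.
- exact: cis_third_sum.
- exact: phases_mod.
- exact: phases_mod.
Qed.

End PhaseFourier.

(** * From commuting squares to commuting averages and back *)

Lemma averages_commute_of_square (C : numClosedFieldType) (s t : 'M[C]_3) :
  s *m s^t* = 1%:M -> t *m t^t* = 1%:M ->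
  s *m s *m s = 1%:M -> t *m t *m t = 1%:M ->
  commuting_square (fun x y : 'M[C]_3 => x *m y) (@psdmx C 3) (@ntrace C 3)
    (scalars3 C) [set x | Ad s x = x] [set x | Ad t x = x] setT ->
  forall x, avg3 (Ad s) (avg3 (Ad t) x) = avg3 (Ad t) (avg3 (Ad s) x).
Proof.
move=> ss tt s3 t3 square x; apply: (ntrace_form_inj (isT : (0 < 3)%N)) => y.
have condF := Ad_cond_exp ss s3; have condG := Ad_cond_exp tt t3.
rewrite setTI in condF; rewrite setTI in condG.
apply/esym/(commuting_square_tau square condF condG (e := 1%:M)).
- by exists 1.
- exact: mul1mx.
- exact: mulmx1.
- by [].
- by [].
- by [].
Qed.

Lemma averages_commute_of_ntrace (C : numClosedFieldType) (s t t' : 'M[C]_3) :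
  let W := shift_tower s t 0 in let W' := shift_tower s t' 0 in
  (forall x y, ntrace (y *m avg3 (Ad W) (avg3 (Ad W') x)) =
               ntrace (y *m avg3 (Ad W') (avg3 (Ad W) x))) ->
  forall x, avg3 (Ad t) (avg3 (Ad t') x) = avg3 (Ad t') (avg3 (Ad t) x).
Proof.
move=> W W' eqW x; apply: tens1_inj; rewrite -!(avg3_tens s).
exact: (ntrace_form_inj (isT : (0 < 3 * 1)%N)).
Qed.

Section FactorSquares.
Variables (R : realType) (H : gns R).
Local Notation rep := (@gns_rep R H _).
Variables s t t' : 'M[R[i]]_3.
Hypothesis ss : s *m s^t* = 1%:M.
Hypothesis tt : t *m t^t* = 1%:M.
Hypothesis tt' : t' *m t'^t* = 1%:M.
Hypothesis s3 : s *m s *m s = 1%:M.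
Hypothesis t3 : t *m t *m t = 1%:M.
Hypothesis t'3 : t' *m t' *m t' = 1%:M.
Local Notation P := (@fixed_factor R H s t).
Local Notation Q := (@fixed_factor R H s t').

Lemma op_trace_rep k (x y : 'M[R[i]]_(dim3 k.+1)) :
  op_trace (rep x \o rep y) = ntrace (x *m y).
Proof. by rewrite -(gns_state H) gns_repM. Qed.

(** The trace identity for the square in R is tested on the operators of level 0, a copy of M_3 on
    which the averages of operators are those of matrices. *)
Lemma averages_commute_of_factor_square :
  op_commuting_square (P `&` Q) P Q (hyperfinite_factor H) ->
  forall x, avg3 (Ad t) (avg3 (Ad t') x) = avg3 (Ad t') (avg3 (Ad t) x).
Proof.
move=> square.
have [U UW] := shift_implemented H ss tt s3 t3.
have [V VW] := shift_implemented H ss tt' s3 t'3.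
have condF := conj_op_cond_exp UW; have condG := conj_op_cond_exp VW.
rewrite -(fixed_factorE s3 t3 UW) in condF.
rewrite -(fixed_factorE s3 t'3 VW) in condG.
apply: (averages_commute_of_ntrace (s := s)) => X y.
(* The trace identity needs a unit in the smallest algebra: the identity operator is the image of a
   matrix fixed by both shifts. *)
have id1 : idfun = @gns_rep R H 0 1%:M by apply/funext => xi; rewrite gns_rep1.
have id_in (r : 'M[R[i]]_3) : r *m r^t* = 1%:M -> @fixed_factor R H s r idfun.
  move=> rr; split; [by [] | by move=> xi; exact: cvg_id |].
  rewrite id1; apply: subset_closure; exists 0%N => //; exists 1%:M => //=.
  exact: (Ad_unit (shift_tower_unitary ss rr 0)).
have := @commuting_square_tau _ _ _ _ _ _ _ _ _ idfun _ _ square condF condG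
  (conj (id_in _ tt) (id_in _ tt')) (fun=> erefl) (fun=> erefl)
  (@hyperfinite_comp R H) (@gns_rep R H 0 y) (@gns_rep R H 0 X)
  (rep_hyperfinite H y) (rep_hyperfinite H X).
rewrite (avg3_conj_op_rep UW) (avg3_conj_op_rep VW).
rewrite (avg3_conj_op_rep VW) (avg3_conj_op_rep UW).
move=> e; rewrite -[LHS](op_trace_rep y) -[RHS](op_trace_rep y).
exact (esym e).
Qed.

(** The implementing unitaries commute, hence so do the averages, which are the conditional
    expectations onto [P] and [Q]. *)
Lemma factor_square (c : R[i]) : c * c^*%R = 1 -> t *m t' = c *: (t' *m t) ->
  op_commuting_square (P `&` Q) P Q (hyperfinite_factor H).
Proof.
move=> cc ttc.
have [U UW] := shift_implemented H ss tt s3 t3.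
have [V VW] := shift_implemented H ss tt' s3 t'3.
have UV := implements_commute ss tt tt' s3 t3 t'3 cc ttc UW VW.
rewrite (fixed_factorE s3 t3 UW) (fixed_factorE s3 t'3 VW).
apply: (commuting_cond_exp_square _ _ (conj_op_cond_exp UW) (conj_op_cond_exp VW)).
- by move=> T [].
- by move=> T [].
move=> T _; apply: avg3_comm.
- exact: (conj_op_linear UW).
- exact: (conj_op_linear VW).
by move=> {}T; apply/funext => xi; rewrite /conj_op /= !UV.
Qed.

End FactorSquares.

Lemma matrix_square (C : numClosedFieldType) (c : C) (g r : 'rV[C]_3) :
  let s := phase_shift g in let t := diag_mx r *m s in
  c * c^*%R = 1 -> c != 1 -> (forall i, r 0 (i - 1) = c * r 0 i) ->
  (forall i, r 0 i * (r 0 i)^*%R = 1) -> (forall i, g 0 i * (g 0 i)^*%R = 1) ->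
  t *m t^t* = 1%:M -> s *m s *m s = 1%:M -> t *m t *m t = 1%:M ->
  commuting_square (fun x y : 'M[C]_3 => x *m y) (@psdmx C 3) (@ntrace C 3)
    (scalars3 C) [set x | Ad s x = x] [set x | Ad t x = x] setT.
Proof.
move=> s t cc c1 r_shift r_mod g_mod tt s3 t3.
have ss : s *m s^t* = 1%:M by exact: phase_shift_unitary.
have condF := Ad_cond_exp ss s3; have condG := Ad_cond_exp tt t3.
rewrite setTI in condF; rewrite setTI in condG.
rewrite -(fixed_both_scalars r_shift c1 r_mod g_mod).
apply: (commuting_cond_exp_square _ _ condF condG).
- by [].
- by [].
move=> x _; apply: avg3_comm.
- exact: Ad_linear.
- exact: Ad_linear.
by move=> y; apply: (Ad_commute _ cc); exact: phase_shift_commute.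
Qed.

(** For cube roots of unity the entries of [r] are y, x^2 and x y^2, a cyclic geometric progression;
    this identifies the commutation scalar as [x * y]. *)
Lemma phase_ratio_shift (R : realType) (a1 a2 b1 b2 : R) :
  let x := cis (a1 - b1) in let y := cis (a2 - b2) in
  let r := phase_steps (phase_ratio (phases a1 a2) (phases b1 b2)) in
  x ^+ 3 = 1 -> y ^+ 3 = 1 -> forall i, r 0 (i - 1) = x * y * r 0 i.
Proof.
move=> x y r x3 y3 i; rewrite /r phase_ratio_steps.
have cV (a : R) : cis a ^+ 3 = 1 -> cis (- a) = cis a ^+ 2.
  by move=> a3; rewrite -cis_conj -[LHS]mul1r -a3 exprSr -mulrA cis_mod mulr1.
have -> : b1 - a1 = - (a1 - b1) by rewrite opprB.
rewrite (cisD (a1 - b1) (- (a2 - b2))) (cV _ x3) (cV _ y3) -/x -/y !mxE.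
case: i => -[|[|[|//]]] ? /=.
- by ring.
- by transitivity (x ^+ 3 * y); [rewrite x3 mul1r|ring].
- by transitivity (y ^+ 3 * x ^+ 2); [rewrite y3 mul1r|ring].
Qed.

Theorem theorem5p10 (R : realType) (H : gns R) (w : R[i])
    (a1 a2 b1 b2 : R) (u v : 'M[R[i]]_3)
    (hw : 3.-primitive_root w)
    (ha1 : 0 <= a1 < 2 * pi) (ha2 : 0 <= a2 < 2 * pi)
    (hb1 : 0 <= b1 < 2 * pi) (hb2 : 0 <= b2 < 2 * pi)
    (hu : u = phaseF3 a1 a2) (hv : v = phaseF3 b1 b2)
    (huv : ~ hadamard_equiv u v) :
  let Ru := hadamard_subfactor H u in
  let Rv := hadamard_subfactor H v in
  let cond_i := op_commuting_square (Ru `&` Rv) Ru Rv (hyperfinite_factor H) in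
  let cond_ii := mx_commuting_square (scalars3 R[i])
               (Ad u @` Delta3 R[i]) (Ad v @` Delta3 R[i]) setT in
  let cond_iii := (cis (a1 - b1), cis (a2 - b2)) \in
    [:: (w, w); (w ^+ 2, w ^+ 2); (1, w); (1, w ^+ 2); (w, 1); (w ^+ 2, 1)] in
  (cond_i <-> cond_ii) /\ (cond_ii <-> cond_iii).
Proof.
set s := phase_unitary a1 a2; set t := phase_unitary b1 b2.
have ss : s *m s^t* = 1%:M := phase_unitary_adj a1 a2.
have tt : t *m t^t* = 1%:M := phase_unitary_adj b1 b2.
have s3 : s *m s *m s = 1%:M := phase_unitary3 a1 a2.
have t3 : t *m t *m t = 1%:M := phase_unitary3 b1 b2.
have [SS S3] := (cshift_unitary R[i], cshift3 R[i]).
have RuE : hadamard_subfactor H u = @fixed_factor R H (cshift R[i]) s.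
  rewrite hu; exact: hadamard_phaseF3E.
have RvE : hadamard_subfactor H v = @fixed_factor R H (cshift R[i]) t.
  rewrite hv; exact: hadamard_phaseF3E.
have AuE : Ad u @` Delta3 R[i] = [set x | Ad s x = x].
  rewrite hu; exact: Ad_phaseF3E.
have AvE : Ad v @` Delta3 R[i] = [set x | Ad t x = x].
  rewrite hv; exact: Ad_phaseF3E.
rewrite hu hv in huv.
move=> Ru Rv cond_i cond_ii cond_iii.
have i_iii : cond_i -> cond_iii.
  rewrite /cond_i /Ru /Rv RuE RvE => square.
  apply: (commuting_averages_cond hw huv).
  exact: (averages_commute_of_factor_square SS ss tt S3 s3 t3 square).
have ii_iii : cond_ii -> cond_iii.
  rewrite /cond_ii AuE AvE => square.
  apply: (commuting_averages_cond hw huv).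
  exact: (averages_commute_of_square ss tt s3 t3 square).
(* Each square gives (iii), so the equivalences follow once (iii) gives both squares. *)
suff iii_both : cond_iii -> cond_i /\ cond_ii.
  split; split; [move=> /i_iii/iii_both h; exact: h.2
    |move=> /ii_iii/iii_both h; exact: h.1|exact: ii_iii
    |move=> /iii_both h; exact: h.2].
(* In this form (iii) supplies the scalar c = xy: the cubes make [s] and [t] commute up to c, and c
   is not 1, which forces the matrix intersection down to the scalars. *)
move=> /(primitive_root3_pairs _ _ hw)[x3 y3 xy].
set r := phase_steps (phase_ratio (phases a1 a2) (phases b1 b2)).
have r_shift := phase_ratio_shift x3 y3; rewrite -/r in r_shift.
have r_mod : forall i, r 0 i * (r 0 i)^*%R = 1.
  by apply: phase_steps_mod; apply: phase_ratio_mod; exact: phases_mod.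
have tE : t = diag_mx r *m s by apply: phase_shift_ratio; exact: phases_mod.
have cc : cis (a1 - b1) * cis (a2 - b2) * (cis (a1 - b1) * cis (a2 - b2))^*%R = 1.
  rewrite -cisD; exact: cis_mod.
split; [rewrite /cond_i /Ru /Rv RuE RvE|rewrite /cond_ii AuE AvE].
  apply: (factor_square H SS ss tt S3 s3 t3 cc).
  rewrite tE; exact: phase_shift_commute.
rewrite tE in tt t3 *.
apply: (matrix_square cc xy r_shift r_mod _ tt s3 t3).
by apply: phase_steps_mod; exact: phases_mod.
Qed.
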